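(* Let $M$ be a monoid. The following are equivalent. (1) $M$ is of type left-$\mathrm F_1$. (2) $M$ is of type left-$\mathrm{FP}_1$. (3) There is a finite subset $A\subseteq M$ such that the right Cayley digraph $\Gamma(M,A)$ is connected as an undirected graph. In particular, any finitely generated monoid is of type left-$\mathrm F_1$.
   Context: Let $M$ be a monoid with the discrete topology. An $M$-set $P$ (set with left $M$-action) is projective if every surjective $M$-equivariant map onto $P$ has an $M$-equivariant section; equivalently $P\cong\coprod_{a\in A}Me_a$ with each $e_a\in M$ idempotent. $M$-sets are regarded as discrete $M$-spaces (an $M$-space being a space with continuous left $M$-action); $B^n$ and $S^{n-1}=\partial B^n$ carry trivial $M$-actions. A projective $M$-CW complex is an $M$-space $X=\varinjlim X_n$ (along inclusions) where $X_0=P_0$ is a projective $M$-set and, for $n\ge1$, $X_n$ is a pushout of $M$-spaces $X_n=X_{n-1}\cup_{P_n\times S^{n-1}}(P_n\times B^n)$ along an $M$-equivariant continuous map $P_n\times S^{n-1}\to X_{n-1}$, with $P_n$ a projective $M$-set. $X_n$ is $M$-finite if $P_0,\dots,P_n$ are finitely generated $M$-sets. A (left) equivariant classifying space for $M$ is a contractible projective $M$-CW complex. $M$ is of type left-$\mathrm F_n$ ($0\le n<\infty$) if it has an equivariant classifying space $X$ with $X_n$ $M$-finite. $M$ is of type left-$\mathrm{FP}_n$ if the trivial left $\mathbb ZM$-module $\mathbb Z$ has a projective resolution $(Q_i)_{i\ge0}$ with $Q_i$ finitely generated for all $i\le n$. For $A\subseteq M$, the (right) Cayley digraph $\Gamma(M,A)$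 has vertex set $M$ and edges in bijection with $M\times A$, the edge $(m,a)$ going from $m$ to $ma$. *)

(* Defs.v *)
From HB Require Import structures.
From mathcomp Require Import all_boot all_order all_algebra.
From mathcomp Require Import finmap.
From mathcomp Require Import all_classical all_reals topology normedtype.
From Stdlib Require Import Relation_Operators.
From mathcomp Require monalg.
(* [monalg] is imported without its notations: they clash with those of
   MathComp-Analysis. *)
Import -(notations) monalg.

Set Implicit Arguments.
Unset Strict Implicit.
Unset Printing Implicit Defensive.

Import Order.TTheory GRing.Theory Num.Theory numFieldNormedType.Exports.

Local Open Scope classical_set_scope.
Local Open Scope ring_scope.

Record mset (M : monoidType) := MSet {
  mset_sort :> choiceType;
  sact : M -> mset_sort -> mset_sort;
  sact1 : forall x, sact 1%g x = x;
  sactM : forall a b x, sact (a * b)%g x = sact a (sact b x)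
}.

Definition mset_equivariant (M : monoidType) (P Q : mset M) (f : P -> Q) :=
  forall m x, f (sact m x) = sact m (f x).

Definition mset_projective (M : monoidType) (P : mset M) :=
  forall (Q : mset M) (f : Q -> P), mset_equivariant f ->
    (forall p, exists q, f q = p) ->
    exists s : P -> Q, mset_equivariant s /\ cancel s f.

Definition mset_fg (M : monoidType) (P : mset M) :=
  exists s : seq P, forall p, exists m, exists2 q, q \in s & p = sact m q.

Record mspace (M : monoidType) := MSpace {
  mspace_sort :> topologicalType;
  tact : M -> mspace_sort -> mspace_sort;
  tact1 : forall x, tact 1%g x = x;
  tactM : forall a b x, tact (a * b)%g x = tact a (tact b x);
  tact_continuous : continuous
    (fun mx : discrete_topology M * mspace_sort => tact mx.1 mx.2)
}.

Definition is_mmap (M : monoidType) (X Y : mspace M) (f : X -> Y) :=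
  continuous f /\ forall m x, f (tact m x) = tact m (f x).

Definition is_miso (M : monoidType) (X Y : mspace M) (f : X -> Y) :=
  is_mmap f /\ exists g : Y -> X, [/\ is_mmap g, cancel f g & cancel g f].

Section DiscreteMSpace.
Variables (M : monoidType) (P : mset M).

Let act (m : M) (x : discrete_topology P) : discrete_topology P := sact m x.

Fact mdiscrete_act1 x : act 1%g x = x. Proof. exact: sact1. Qed.

Fact mdiscrete_actM a b x : act (a * b)%g x = act a (act b x).
Proof. exact: sactM. Qed.

Fact mdiscrete_continuous : continuous
  (fun mx : discrete_topology M * discrete_topology P => act mx.1 mx.2).
Proof.
move=> [m x] U /nbhs_singleton Ux; exists ([set m], [set x]) => /=.
  by split; exact: discrete_set1.
by move=> [_ _] /= [-> ->].
Qed.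

Definition mdiscrete : mspace M :=
  @MSpace M (discrete_topology P) act mdiscrete_act1 mdiscrete_actM
    mdiscrete_continuous.

End DiscreteMSpace.

(* The product P * K of a (discrete) M-set P and a space K with trivial
   M-action. *)
Section ProductMSpace.
Variables (M : monoidType) (P : mset M) (K : topologicalType).

Let act (m : M) (x : discrete_topology P * K) : discrete_topology P * K :=
  (sact m x.1, x.2).

Fact mprod_act1 x : act 1%g x = x.
Proof. by case: x => p k; rewrite /act sact1. Qed.

Fact mprod_actM a b x : act (a * b)%g x = act a (act b x).
Proof. by rewrite /act sactM. Qed.

Fact mprod_continuous : continuous
  (fun mx : discrete_topology M * (discrete_topology P * K)%type =>
     act mx.1 mx.2).
Proof.
move=> [m [p k]] U [[V W] /= [Vp Wk] VWU].
exists ([set m], [set p] `*` W) => /=.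
  split; first exact: discrete_set1.
  by exists ([set p], W) => //=; split=> //; exact: discrete_set1.
move=> [_ [_ l]] /= [-> [-> Wl]]; apply: VWU; split=> //=.
exact: nbhs_singleton Vp.
Qed.

Definition mprod : mspace M :=
  @MSpace M (discrete_topology P * K)%type act mprod_act1 mprod_actM
    mprod_continuous.

End ProductMSpace.

Definition is_mpushout (M : monoidType) (A B C D : mspace M)
    (f : A -> B) (g : A -> C) (j : B -> D) (k : C -> D) :=
  [/\ [/\ is_mmap f, is_mmap g, is_mmap j & is_mmap k],
      (forall a, j (f a) = k (g a)) &
      forall (Y : mspace M) (u : B -> Y) (v : C -> Y),
        is_mmap u -> is_mmap v -> (forall a, u (f a) = v (g a)) ->
        exists! w : D -> Y,
          [/\ is_mmap w, (forall b, w (j b) = u b) & forall c, w (k c) = v c]].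

Definition is_msequential_colimit (M : monoidType) (Xs : nat -> mspace M)
    (i : forall n, Xs n -> Xs n.+1) (X : mspace M) (j : forall n, Xs n -> X) :=
  [/\ forall n, is_mmap (@i n), forall n, is_mmap (@j n),
      (forall n x, j n.+1 (i n x) = j n x) &
      forall (Y : mspace M) (u : forall n, Xs n -> Y),
        (forall n, is_mmap (@u n)) -> (forall n x, u n.+1 (i n x) = u n x) ->
        exists! w : X -> Y, is_mmap w /\ forall n x, w (j n x) = u n x].

(* Euclidean balls (the library norm on row vectors is the sup norm). The
   sphere is a subspace of the ball. *)
Definition euclidean_ball (R : realType) (n : nat) : set 'rV[R]_n :=
  [set x | \sum_(i < n) x ord0 i ^+ 2 <= 1].
Arguments euclidean_ball : clear implicits.

Definition euclidean_sphere (R : realType) (n : nat) :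
    set (euclidean_ball R n) :=
  [set x | \sum_(i < n) (set_val x : 'rV[R]_n) ord0 i ^+ 2 = 1].
Arguments euclidean_sphere : clear implicits.

(* Pushouts and colimits are given by their universal properties, so that the
   spaces [skel n] are determined only up to isomorphism of M-spaces; the maps
   [skel_incl] and [skel_colim] are the inclusions of the skeleta. The cells
   of dimension n are indexed by the M-set [cells n]. *)
Record projective_mcw (R : realType) (M : monoidType) := ProjectiveMCW {
  mcw_space :> mspace M;
  cells : nat -> mset M;
  skel : nat -> mspace M;
  skel_incl : forall n, skel n -> skel n.+1;
  skel_colim : forall n, skel n -> mcw_space;
  vertex_map : mdiscrete (cells 0) -> skel 0;
  attaching_map :
    forall n, mprod (cells n.+1) (euclidean_sphere R n.+1) -> skel n;
  characteristic_map :
    forall n, mprod (cells n.+1) (euclidean_ball R n.+1) -> skel n.+1;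
  cells_projective : forall n, mset_projective (cells n);
  vertex_map_iso : is_miso vertex_map;
  skel_pushout : forall n,
    @is_mpushout M (mprod (cells n.+1) (euclidean_sphere R n.+1))
      (mprod (cells n.+1) (euclidean_ball R n.+1)) (skel n) (skel n.+1)
      (fun x => (x.1, set_val x.2)) (@attaching_map n)
      (@characteristic_map n) (@skel_incl n);
  mcw_colimit : is_msequential_colimit skel_incl skel_colim
}.

Definition contractible (R : realType) (X : topologicalType) :=
  exists (x0 : X) (H : X * R -> X),
    [/\ {within [set: X] `*` `[0, 1], continuous H},
        forall x, H (x, 0) = x & forall x, H (x, 1) = x0].

Definition equivariant_classifying_space (R : realType) (M : monoidType)
    (X : projective_mcw R M) :=
  contractible R X.

Definition skel_mfinite (R : realType) (M : monoidType)
    (X : projective_mcw R M) (n : nat) :=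
  forall i, (i <= n)%N -> mset_fg (cells X i).

Definition left_F (R : realType) (M : monoidType) (n : nat) :=
  exists X : projective_mcw R M,
    equivariant_classifying_space X /\ skel_mfinite X n.

Definition module_projective (A : nzRingType) (P : lmodType A) :=
  forall (U V : lmodType A) (g : {linear U -> V}) (f : {linear P -> V}),
    (forall v, exists u, g u = v) ->
    exists h : {linear P -> U}, forall p, g (h p) = f p.

Definition module_fg (A : nzRingType) (V : lmodType A) :=
  exists (n : nat) (x : 'I_n -> V),
    forall v, exists c : 'I_n -> A, v = \sum_(i < n) c i *: x i.

Record projective_resolution (A : nzRingType) (V : lmodType A) :=
  ProjectiveResolution {
  res_module :> nat -> lmodType A;
  res_diff : forall n, {linear res_module n.+1 -> res_module n};
  res_aug : {linear res_module 0 -> V};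
  res_projective : forall n, module_projective (res_module n);
  res_aug_surj : forall v, exists x, res_aug x = v;
  res_exact0 : forall x, res_aug x = 0 <-> exists y, res_diff 0 y = x;
  res_exactS : forall n x,
    res_diff n x = 0 <-> exists y, res_diff n.+1 y = x
}.

Definition trivial_module (M : monoidType) : Type := int.

Section MonoidRing.
Variable M : monoidType.

(* Finitely supported functions M -> int. The ring structure that [malg]
   carries in its library requires a monoid without nontrivial units, hence
   this alias, of which only the additive group is taken from [malg]. *)
Definition monoid_ring : Type := malg M int.

HB.instance Definition _ := GRing.Zmodule.on monoid_ring.

Implicit Types (g h : monoid_ring) (a b : M).

Definition mr_one : monoid_ring := mkmalgU 1%g (1 : int).

Definition mr_mul g h : monoid_ring :=
  \sum_(a <- msupp g) \sum_(b <- msupp h)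
    mkmalgU (a * b)%g (mcoeff a g * mcoeff b h).

Definition augmentation g : int := \sum_(a <- msupp g) mcoeff a g.

Lemma mr_mulE (d e : {fset M}) g h :
  (msupp g `<=` d -> msupp h `<=` e ->
  mr_mul g h = \sum_(a <- d) \sum_(b <- e)
    mkmalgU (a * b)%g (mcoeff a g * mcoeff b h))%fset.
Proof.
move=> le_d le_e; rewrite /mr_mul (big_fset_incl _ le_d) /=.
  apply: eq_bigr => a _; apply: big_fset_incl => // b _ /mcoeff_outdom ->.
  by rewrite mulr0 monalgU0.
move=> a _ /mcoeff_outdom ga.
by rewrite big1 // => b _; rewrite ga mul0r monalgU0.
Qed.

Lemma mr_mulDl : left_distributive mr_mul +%R.
Proof.
move=> g1 g2 h; have sl := fsubsetUl (msupp g1) (msupp g2).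
have sr := fsubsetUr (msupp g1) (msupp g2); have sh := fsubset_refl (msupp h).
rewrite (mr_mulE sl sh) (mr_mulE sr sh) (mr_mulE (msuppD_le _ _) sh).
rewrite -big_split; apply: eq_bigr => a _; rewrite -big_split.
by apply: eq_bigr => b _; rewrite mcoeffD mulrDl monalgUD.
Qed.

Lemma mr_mulDr : right_distributive mr_mul +%R.
Proof.
move=> g h1 h2; have sl := fsubsetUl (msupp h1) (msupp h2).
have sr := fsubsetUr (msupp h1) (msupp h2); have sg := fsubset_refl (msupp g).
rewrite (mr_mulE sg sl) (mr_mulE sg sr) (mr_mulE sg (msuppD_le _ _)).
rewrite -big_split; apply: eq_bigr => a _; rewrite -big_split.
by apply: eq_bigr => b _; rewrite mcoeffD mulrDr monalgUD.
Qed.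

Lemma mr_mul0r : left_zero 0 mr_mul.
Proof. by move=> g; rewrite /mr_mul msupp0 big_seq_fset0. Qed.

Lemma mr_mulr0 : right_zero 0 mr_mul.
Proof.
by move=> g; rewrite /mr_mul msupp0 big1 // => a _; rewrite big_seq_fset0.
Qed.

Lemma mr_mul_suml I (r : seq I) (F : I -> monoid_ring) h :
  mr_mul (\sum_(i <- r) F i) h = \sum_(i <- r) mr_mul (F i) h.
Proof.
exact: (big_morph (mr_mul^~ h) (fun _ _ => mr_mulDl _ _ _) (mr_mul0r h)).
Qed.

Lemma mr_mul_sumr I (r : seq I) (F : I -> monoid_ring) g :
  mr_mul g (\sum_(i <- r) F i) = \sum_(i <- r) mr_mul g (F i).
Proof.
exact: (big_morph (mr_mul g) (fun _ _ => mr_mulDr _ _ _) (mr_mulr0 g)).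
Qed.

Lemma mr_mulUU a b (x y : int) :
  mr_mul (mkmalgU a x) (mkmalgU b y) = mkmalgU (a * b)%g (x * y).
Proof. by rewrite (mr_mulE msuppU_le msuppU_le) !big_seq_fset1 !mcoeffUU. Qed.

Lemma mr_E g : g = \sum_(a <- msupp g) (mkmalgU a (mcoeff a g) : monoid_ring).
Proof. exact: monalgE. Qed.

Fact mr_mul1r : left_id mr_one mr_mul.
Proof.
move=> g; rewrite {1}(mr_E g) mr_mul_sumr [RHS]mr_E.
by apply: eq_bigr => a _; rewrite mr_mulUU mul1g mul1r.
Qed.

Fact mr_mulr1 : right_id mr_one mr_mul.
Proof.
move=> g; rewrite {1}(mr_E g) mr_mul_suml [RHS]mr_E.
by apply: eq_bigr => a _; rewrite mr_mulUU mulg1 mulr1.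
Qed.

Fact mr_mulA : associative mr_mul.
Proof.
move=> f g h; rewrite (mr_E f) !mr_mul_suml; apply: eq_bigr => a _.
rewrite (mr_E g) mr_mul_suml !mr_mul_sumr mr_mul_suml; apply: eq_bigr => b _.
rewrite (mr_E h) !mr_mul_sumr; apply: eq_bigr => c _.
by rewrite !mr_mulUU mulgA mulrA.
Qed.

Fact mr_one_neq0 : mr_one != 0.
Proof. by rewrite monalgU_eq0 oner_eq0. Qed.

HB.instance Definition _ := GRing.Zmodule_isNzRing.Build monoid_ring
  mr_mulA mr_mul1r mr_mulr1 mr_mulDl mr_mulDr mr_one_neq0.

Lemma augmentationE (d : {fset M}) g :
  (msupp g `<=` d)%fset -> augmentation g = \sum_(a <- d) mcoeff a g.
Proof. by move=> sd; apply: big_fset_incl => // a _ /mcoeff_outdom. Qed.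

Lemma augmentationU a (x : int) : augmentation (mkmalgU a x) = x.
Proof. by rewrite (augmentationE msuppU_le) big_seq_fset1 mcoeffUU. Qed.

Lemma augmentationD : {morph augmentation : g h / g + h}.
Proof.
move=> g h; rewrite (augmentationE (msuppD_le _ _)).
rewrite (augmentationE (fsubsetUl _ (msupp h))).
rewrite (augmentationE (fsubsetUr (msupp g) _)) -big_split.
by apply: eq_bigr => a _; rewrite mcoeffD.
Qed.

Lemma augmentation0 : augmentation 0 = 0.
Proof. by rewrite /augmentation msupp0 big_seq_fset0. Qed.

Lemma augmentation_sum I (r : seq I) (F : I -> monoid_ring) :
  augmentation (\sum_(i <- r) F i) = \sum_(i <- r) augmentation (F i).
Proof. exact: (big_morph augmentation augmentationD augmentation0). Qed.

Lemma augmentationM : {morph augmentation : g h / g * h}.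
Proof.
move=> g h; rewrite (_ : g * h = mr_mul g h)// augmentation_sum mulr_suml.
apply: eq_bigr => a _; rewrite augmentation_sum mulr_sumr.
by apply: eq_bigr => b _; rewrite augmentationU.
Qed.

HB.instance Definition _ := GRing.Zmodule.on (trivial_module M).

Definition trivial_scale g (z : trivial_module M) : trivial_module M :=
  augmentation g * (z : int).

Fact trivial_scaleA g h z :
  trivial_scale g (trivial_scale h z) = trivial_scale (g * h) z.
Proof. by rewrite /trivial_scale augmentationM mulrA. Qed.

Fact trivial_scale1 : left_id 1 trivial_scale.
Proof. by move=> z; rewrite /trivial_scale augmentationU mul1r. Qed.

Fact trivial_scaleDr : right_distributive trivial_scale +%R.
Proof. by move=> g y z; exact: mulrDr. Qed.

Fact trivial_scaleDl z : {morph trivial_scale^~ z : g h / g + h}.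
Proof. by move=> g h; rewrite /trivial_scale augmentationD mulrDl. Qed.

HB.instance Definition _ :=
  GRing.Zmodule_isLmodule.Build monoid_ring (trivial_module M)
    trivial_scaleA trivial_scale1 trivial_scaleDr trivial_scaleDl.

End MonoidRing.

Definition left_FP (M : monoidType) (n : nat) :=
  exists Q : @projective_resolution (monoid_ring M) (trivial_module M),
    forall i, (i <= n)%N -> module_fg (Q i).

Record digraph := Digraph {
  vertex : Type;
  edge : Type;
  source : edge -> vertex;
  target : edge -> vertex
}.

Definition cayley_digraph (M : monoidType) (A : set M) : digraph :=
  @Digraph M (M * A)%type (fun e => e.1) (fun e => (e.1 * set_val e.2)%g).
Arguments cayley_digraph : clear implicits.

Definition connected_undirected (G : digraph) :=
  forall u v : vertex G, clos_refl_sym_trans (vertex G)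
    (fun x y => exists e : edge G, source e = x /\ target e = y) u v.

Definition monoid_fg (M : monoidType) :=
  exists2 A : set M, finite_set A &
    forall m, exists2 s : seq M, (forall a, a \in s -> A a) &
      m = (\prod_(a <- s) a)%g.

(* Main.v *)
From HB Require Import structures.
Require Import Defs.
From mathcomp Require Import all_boot all_order all_algebra finmap.
From mathcomp Require Import all_classical all_reals topology normedtype.
From Stdlib Require Import Relation_Operators.
From mathcomp Require monalg.
Import -(notations) monalg.
From mathcomp Require Import realfun.
From mathcomp Require Import ring lra.

Set Implicit Arguments.
Unset Strict Implicit.
Unset Printing Implicit Defensive.

Import Order.TTheory GRing.Theory Num.Theory numFieldNormedType.Exports.

Local Open Scope classical_set_scope.
Local Open Scope ring_scope.

(** Both finiteness properties are compared with the third condition, that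
    some digraph Gamma(M, A) with A finite is connected.

    From left-FP_1 to the digraph. Let Q be the resolution, q in Q_0 of
    augmentation 1, and h : Q_0 -> ZM a lift of the augmentation of Q_0
    through that of ZM. Take for A the supports of h q and of h (d x_i), the
    x_i generating Q_1. The additive map phi : ZM -> Z that sums the
    coefficients over the component of 1 satisfies
    phi (g w) = phi g * augmentation w when w is supported in A
    ([component_sumM]), because the edges m -> m a stay in a component. For g
    of augmentation 0, exactness writes g q as a combination of the d x_i,
    whence phi g = phi (g (h q)) = 0; with g = m - 1, the element m is in the
    component of 1 ([left_FP1_cayley]).

    From the digraph to left-FP_1. Connectedness says that every m - 1 is a
    sum of elements +- x (a - 1) with x in M and a in A, so these a - 1
    generate the augmentation ideal and ZM^A -> ZM -> Z is the beginning of a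
    resolution, which is continued by free modules on kernels
    ([left_FP1_of_cayley]).

    From the digraph to left-F_1. Start from the discrete M-set M and attach
    the 1-cells M x A, which gives the geometric realization of Gamma(M, A).
    Then, for each n >= 1, attach a free orbit of (n+1)-cells along every
    continuous map from the n-sphere to X_n. By induction on n, the inclusion of
    X_n in X_(n+1) is homotopic to a constant map, by a homotopy that extends
    the previous one: connectedness provides the paths for n = 0, and over each
    new (n+1)-cell the problem is to extend to a ball a map given on the
    boundary of the cylinder B^(n+1) x [0, 1], which is a sphere whose maps to
    X_(n+1) were all filled in X_(n+2) ([homotopy_fill],
    [contraction_extends]). These homotopies glue to a contraction of
    the colimit; it is continuous on the product with the real line because a
    function out of a final topology may be curried
    ([final_uncurry_continuous]). No homotopy theory (cellular approximation,
    the Whitehead theorem) enters, since cells fill all spheres of X_n and not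
    only representatives of homotopy classes.

    From left-F_1 to the digraph. A projective M-set P_0 has an equivariant
    map v to M. Let A be made of one value of v and of the values of v at the
    two ends of each generating 1-cell. The map that sends a vertex p to the
    set of x with x (v p) in the component of 1 is an equivariant map to a
    discrete M-set which takes the same value at both ends of each edge.
    Spheres of positive dimension being connected, it extends over all
    skeleta to a map from X to a discrete space ([extend_to_discrete]), which
    is constant as X is contractible ([left_F1_cayley]). *)

(** * Free modules and projective resolutions *)

Section FreeModules.
Variables (A : nzRingType) (S : choiceType) (V : lmodType A).

(** [malg S A] is the free [A]-module on [S]; this is the linear map out of it
    with prescribed values on the basis. *)
Definition free_lift (f : S -> V) (g : malg S A) : V :=
  \sum_(s <- msupp g) mcoeff s g *: f s.

Lemma free_liftE (f : S -> V) (d : {fset S}) g :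
  (msupp g `<=` d)%fset -> free_lift f g = \sum_(s <- d) mcoeff s g *: f s.
Proof.
move=> sd; apply: big_fset_incl => // s _ /mcoeff_outdom ->.
by rewrite scale0r.
Qed.

Lemma free_lift_is_linear (f : S -> V) : linear (free_lift f).
Proof.
move=> c g h; pose d := (msupp g `|` msupp h `|` msupp (c *: g + h))%fset.
have sg : (msupp g `<=` d)%fset.
  by rewrite /d -fsetUA fsubsetUl.
have sh : (msupp h `<=` d)%fset.
  by rewrite /d (fsetUC (msupp g)) -fsetUA fsubsetUl.
rewrite (free_liftE f sg) (free_liftE f sh) (free_liftE f (d := d) (fsubsetUr _ _)).
rewrite scaler_sumr -big_split; apply: eq_bigr => s _.
by rewrite mcoeffD mcoeffZ scalerDl scalerA.
Qed.

HB.instance Definition _ (f : S -> V) :=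
  GRing.isLinear.Build A (malg S A) V *:%R (free_lift f)
    (free_lift_is_linear f).

Definition free_linear (f : S -> V) : {linear malg S A -> V} := free_lift f.

Lemma free_linearE (f : S -> V) g :
  free_linear f g = \sum_(s <- msupp g) mcoeff s g *: f s.
Proof. by []. Qed.

Lemma free_liftU (f : S -> V) s : free_linear f (mkmalgU s 1) = f s.
Proof.
rewrite /= (free_liftE f msuppU_le) big_seq_fset1 mcoeffUU.
by rewrite scale1r.
Qed.

End FreeModules.

Lemma malg_scaleE (A : nzRingType) (S : choiceType) (g : malg S A) :
  g = \sum_(s <- msupp g) mcoeff s g *: (mkmalgU s 1 : malg S A).
Proof.
rewrite {1}(monalgE g); apply: eq_bigr => s _; apply/malgP => t.
by rewrite mcoeffZ !mcoeffU mulrnAr mulr1.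
Qed.

Lemma free_projective (A : nzRingType) (S : choiceType) :
  module_projective (malg S A).
Proof.
move=> U V g f gsurj; have [u gu] := choice (fun s : S => gsurj (f (mkmalgU s 1))).
exists (free_linear u) => p; rewrite [p in RHS]malg_scaleE /= /free_lift.
by rewrite !linear_sum; apply: eq_bigr => s _; rewrite !linearZ gu.
Qed.

Lemma free_fg (A : nzRingType) n : module_fg (malg 'I_n A).
Proof.
exists n, (fun i => mkmalgU i 1) => v; exists (mcoeff^~ v).
apply/malgP => j; rewrite (raddf_sum (mcoeff j)) (bigD1 j) //= big1 ?addr0.
  by rewrite mcoeffZ mcoeffUU mulr1.
by move=> i /negbTE ij; rewrite mcoeffZ mcoeffU ij mulr0.
Qed.

Lemma regular_projective (A : nzRingType) :
  module_projective (A^o : lmodType A).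
Proof.
move=> U V g f gsurj; have [u gu] := gsurj (f 1).
have lin : linear (fun a : A^o => a *: u) by move=> c a b; rewrite scalerDl scalerA.
pose hL := GRing.isLinear.Build A A^o U *:%R _ lin.
pose h : {linear A^o -> U} := HB.pack (fun a : A^o => a *: u) hL.
exists h => p; rewrite /= linearZ /= gu -linearZ /=.
by congr (f _); exact: mulr1.
Qed.

Section Resolutions.
Variable A : nzRingType.

Record linear_arrow := LinearArrow {
  arrow_src : lmodType A;
  arrow_tgt : lmodType A;
  arrow_map : {linear arrow_src -> arrow_tgt}
}.

Arguments arrow_map : clear implicits.

Definition arrow_ker (d : linear_arrow) : set (arrow_src d) :=
  [set x | arrow_map d x = 0].

Arguments arrow_ker : clear implicits.

(** Every kernel is the image of the free module on its own elements, so that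
    iterating this operation prolongs any exact beginning to a resolution. The
    target of the new arrow is the source of the old one by conversion, hence
    the iterates can be chained into a complex without transport. *)
Definition cover_ker (d : linear_arrow) : linear_arrow :=
  @LinearArrow (malg (arrow_ker d) A) (arrow_src d)
    (free_linear (fun x : arrow_ker d => set_val x)).

Lemma cover_ker_exact (d : linear_arrow) x :
  arrow_map d x = 0 <-> exists y, arrow_map (cover_ker d) y = x.
Proof.
split=> [dx0|[y <-]].
  by exists (mkmalgU (exist _ x (mem_set dx0) : arrow_ker d) 1); exact: free_liftU.
rewrite /= /free_lift linear_sum big1 // => s _.
by rewrite linearZ /= (set_valP s) scaler0.
Qed.

(** Only the first two modules matter for finiteness in degrees at most 1: they
    are kept, and the other ones are free on kernels. *)
Lemma resolution_extending (V P Q : lmodType A) (eps : {linear P -> V})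
    (d : {linear Q -> P}) :
  module_projective P -> module_projective Q ->
  (forall v, exists x, eps x = v) ->
  (forall x, eps x = 0 <-> exists y, d y = x) ->
  exists X : projective_resolution V,
    forall T : lmodType A -> Prop, T P -> T Q ->
      forall i, (i <= 1)%N -> T (X i).
Proof.
move=> projP projQ surj exact0.
pose stage n := iter n cover_ker (LinearArrow d).
have proj n : module_projective (arrow_tgt (stage n)) /\
              module_projective (arrow_src (stage n)).
  by elim: n => [|n [_ IH]] //; split=> //; exact: free_projective.
exists (@ProjectiveResolution A V (fun n => arrow_tgt (stage n))
  (fun n => arrow_map (stage n)) eps (fun n => (proj n).1) surj exact0
  (fun n x => @cover_ker_exact (stage n) x)).
by move=> T TP TQ [|[|i]].
Qed.

End Resolutions.

(** * Components of Cayley digraphs *)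

(** The relation of [connected_undirected], unfolded for [cayley_digraph M A]. *)
Definition cayley_connect (M : monoidType) (A : set M) (x y : M) : Prop :=
  clos_refl_sym_trans M
    (fun x y => exists e : (M * A)%type, e.1 = x /\ (e.1 * set_val e.2)%g = y)
    x y.

Section Cayley.
Variables (M : monoidType) (A : set M).

Lemma cayley_edge m a : A a -> cayley_connect A m (m * a)%g.
Proof.
by move=> Aa; apply: rst_step; exists (m, exist _ a (mem_set Aa)).
Qed.

(** The edges from [m] to [m * a] and to [m * b] form a path between their
    ends. *)
Lemma cayley_connect_edge x y m a b : A a -> A b ->
  x = (m * a)%g -> y = (m * b)%g -> cayley_connect A x y.
Proof.
move=> Aa Ab -> ->; apply: rst_trans (cayley_edge m Ab).
exact/rst_sym/cayley_edge.
Qed.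

End Cayley.

Lemma cayley_connected (M : monoidType) (A : set M) :
  (forall m, cayley_connect A 1%g m) ->
  connected_undirected (cayley_digraph M A).
Proof. by move=> H u v; apply: rst_trans (H v); exact/rst_sym/H. Qed.

(** * The augmentation ideal and type left-FP_1 *)

Section Augmentation.
Variable M : monoidType.
Notation ZM := (monoid_ring M).

Lemma augmentation_is_linear :
  linear (augmentation (M:=M) : ZM^o -> trivial_module M).
Proof. by move=> c g h; rewrite augmentationD augmentationM. Qed.

Definition aug_linear : {linear ZM^o -> trivial_module M} :=
  HB.pack (augmentation (M:=M) : ZM^o -> trivial_module M)
    (GRing.isLinear.Build ZM ZM^o (trivial_module M) *:%R _
       augmentation_is_linear).

Lemma aug_linear_surj (v : trivial_module M) : exists x, aug_linear x = v.
Proof. by exists (mkmalgU 1%g (v : int)); exact: augmentationU. Qed.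

Definition mr_elt (m : M) : ZM := mkmalgU m (1 : int).

Lemma mr_elt1 : mr_elt 1%g = 1. Proof. by []. Qed.

Lemma mr_eltM m n : mr_elt (m * n)%g = mr_elt m * mr_elt n.
Proof. by rewrite [RHS]mr_mulUU mulr1. Qed.

Lemma augmentation_elt m : augmentation (mr_elt m) = 1.
Proof. exact: augmentationU. Qed.

Lemma augmentation_elt_sub1 m : augmentation (mr_elt m - 1) = 0.
Proof.
have := augmentationD (mr_elt m - 1) (mr_elt 1%g).
by rewrite subrK !augmentation_elt => /esym/(canRL (addrK _)); rewrite subrr.
Qed.

(** The elements [m - 1] span the augmentation ideal over the integers: subtract
    from [g], the sum of the [g_m m], its augmentation, the sum of the
    [g_m 1]. *)
Lemma augmentation_ker_sum (g : ZM) : augmentation g = 0 ->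
  g = \sum_(m <- msupp g) (mkmalgU 1%g (mcoeff m g) : ZM) * (mr_elt m - 1).
Proof.
move=> g0.
under eq_bigr do rewrite mulrBr mulr1 [_ * mr_elt _]mr_mulUU mul1g mulr1.
rewrite sumrB -mr_E -(raddf_sum (mkmalgU 1%g)).
by rewrite -[\sum_(_ <- _) _]/(augmentation g) g0 raddf0 subr0.
Qed.

End Augmentation.

Section ComponentCount.
Variables (M : monoidType) (A : set M).
Notation ZM := (monoid_ring M).

Definition component_weight (m : M) : int := (`[< cayley_connect A 1%g m >] : nat)%:Z.

(** The additive extension to the monoid ring of the indicator function of the
    component of 1. *)
Definition component_sum (g : ZM) : int :=
  \sum_(m <- msupp g) mcoeff m g * component_weight m.

Lemma component_sumE (d : {fset M}) (g : ZM) : (msupp g `<=` d)%fset ->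
  component_sum g = \sum_(m <- d) mcoeff m g * component_weight m.
Proof.
move=> sd; apply: big_fset_incl => // a _ /mcoeff_outdom ->.
by rewrite mul0r.
Qed.

Lemma component_sumD : {morph component_sum : g h / g + h}.
Proof.
move=> g h; rewrite (component_sumE (msuppD_le _ _)).
rewrite (component_sumE (fsubsetUl _ (msupp h))).
rewrite (component_sumE (fsubsetUr (msupp g) _)) -big_split.
by apply: eq_bigr => a _; rewrite mcoeffD mulrDl.
Qed.

Lemma component_sum0 : component_sum 0 = 0.
Proof. by rewrite /component_sum msupp0 big_seq_fset0. Qed.

Lemma component_sum_sum I (r : seq I) (F : I -> ZM) :
  component_sum (\sum_(i <- r) F i) = \sum_(i <- r) component_sum (F i).
Proof. exact: (big_morph _ component_sumD component_sum0). Qed.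

Lemma component_sumU m (x : int) :
  component_sum (mkmalgU m x) = x * component_weight m.
Proof. by rewrite (component_sumE msuppU_le) big_seq_fset1 mcoeffUU. Qed.

(** Right multiplication by an element of [A] preserves each component, so that
    only the sum of the coefficients of [w] matters. *)
Lemma component_sumM (g w : ZM) : (forall a, a \in msupp w -> A a) ->
  component_sum (g * w) = component_sum g * augmentation w.
Proof.
move=> wA; rewrite (_ : g * w = mr_mul g w) // component_sum_sum mulr_suml.
apply: eq_bigr => m _; rewrite component_sum_sum mulr_sumr !big_seq.
apply: eq_bigr => a /wA Aa; rewrite component_sumU mulrAC; congr (_ * _ * _).
rewrite /component_weight; congr (Posz (nat_of_bool _)).
apply: asbool_equiv_eq; split=> h; apply: rst_trans h _.
  exact/rst_sym/cayley_edge.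
exact: cayley_edge.
Qed.

End ComponentCount.

(** The set [A] is chosen so that [component_sum A] turns right multiplication
    by [h q] and by the [h (d x_i)] into multiplication by their augmentations,
    which are 1 and 0. *)
Lemma left_FP1_cayley (M : monoidType) : left_FP M 1 ->
  exists2 A : set M, finite_set A & connected_undirected (cayley_digraph M A).
Proof.
move=> [Q fgQ]; have [n [x genx]] := fgQ 1%N isT.
have [q augq] := res_aug_surj Q (1 : int).
have [h hP] := res_projective (res_aug Q) (@aug_linear_surj M).
pose hq : monoid_ring M := h q.
pose hd i : monoid_ring M := h (res_diff Q 0 (x i)).
pose As := (msupp hq : seq M) ++ flatten [seq (msupp (hd i) : seq M) | i <- enum 'I_n].
exists [set` As]; first by apply/finite_seqP; exists As.
set A := [set` As]; have hqA a : a \in msupp hq -> A a.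
  by move=> aq; rewrite /A /= mem_cat aq.
have hdA i a : a \in msupp (hd i) -> A a.
  move=> ad; rewrite /A /= mem_cat; apply/orP; right; apply/flatten_mapP.
  by exists i => //; rewrite mem_enum.
have aug_hq : augmentation hq = 1 by rewrite -[LHS]/(aug_linear M (h q)) hP.
have aug_hd i : augmentation (hd i) = 0.
  rewrite -[LHS]/(aug_linear M (h _)) hP.
  exact: (proj2 (@res_exact0 _ _ Q _) (ex_intro _ (x i) erefl)).
apply: cayley_connected => m; pose g : monoid_ring M := mr_elt m - 1.
have aug_g : augmentation g = 0 by exact: augmentation_elt_sub1.
(* [g *: q] has augmentation 0, since [g] has. *)
have [y dy] : exists y, res_diff Q 0 y = g *: q.
  apply: (proj1 (@res_exact0 _ _ Q _)); rewrite linearZ augq.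
  by rewrite -[LHS]/(augmentation g * 1) aug_g mul0r.
have [c yc] := genx y.
have g0 : component_sum A g = 0.
  rewrite -[LHS]mulr1 -aug_hq -(component_sumM _ hqA).
  have -> : g * hq = \sum_(i < n) c i * hd i.
    have : g *: h q = \sum_(i < n) c i *: h (res_diff Q 0 (x i)).
      rewrite -linearZ -dy yc.
      by rewrite !linear_sum; apply: eq_bigr => i _; rewrite !linearZZ.
    exact.
  rewrite component_sum_sum big1 // => i _.
  by rewrite (component_sumM _ (@hdA i)) aug_hd mulr0.
have := component_sumD A g (mr_elt 1%g); rewrite subrK g0 add0r !component_sumU.
rewrite !mul1r /component_weight; case: asboolP => // _.
by case: asboolP => // [[]]; exact: rst_refl.
Qed.

(** The image of [d], which sends the basis vector of [a] to [a - 1], is a left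
    ideal, so the pairs [(m, m')] with [m - m'] in it form an equivalence
    relation; as [m * a - m = m * (a - 1)], it contains the edges of the
    Cayley digraph. *)
Lemma left_FP1_of_cayley (M : monoidType) (A : set M) : finite_set A ->
  connected_undirected (cayley_digraph M A) -> left_FP M 1.
Proof.
move=> /finite_seqP[s As] conn; pose a (i : 'I_(size s)) := tnth (in_tuple s) i.
have sA x : A x -> x \in s by rewrite As.
pose d := free_linear (fun i => (mr_elt (a i) - 1 : (monoid_ring M)^o)).
pose e (i : 'I_(size s)) : malg 'I_(size s) (monoid_ring M) := mkmalgU i 1.
have dU i : d (e i) = mr_elt (a i) - 1 by exact: free_liftU.
pose im (g : (monoid_ring M)^o) := exists y, d y = g.
have im0 : im 0 by exists 0; exact: linear0.
have imD g h : im g -> im h -> im (g + h).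
  by move=> [y <-] [z <-]; exists (y + z); rewrite linearD.
have imN g : im g -> im (- g).
  by move=> [y <-]; exists (- y); rewrite linearN.
have imZ c g : im g -> im (c *: g).
  by move=> [y <-]; exists (c *: y); rewrite linearZ.
have imS (I : Type) (r : seq I) (F : I -> (monoid_ring M)^o) :
    (forall i, im (F i)) -> im (\sum_(i <- r) F i).
  by move=> imF; elim/big_ind: _.
have im_elt m : im (mr_elt m - 1).
  have : cayley_connect A m 1%g by exact: conn.
  rewrite -[1](mr_elt1 M).
  elim=> {m} [m m' [[m1 b] /= [<- <-]]|m|m m' _ imm|m m' m'' _ imm _ imm'].
  - have /tnthP[i bi] : set_val b \in in_tuple s by apply: sA; exact: set_valP.
    rewrite bi mr_eltM -opprB -[X in _ - X]mulr1 -mulrBr; apply: imN.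
    by apply: (imZ (mr_elt m1)); exists (e i).
  - by rewrite subrr.
  - by rewrite -opprB; exact: imN.
  - by rewrite -(subrKA (mr_elt m')); exact: imD.
have exact0 g : aug_linear M g = 0 <-> im g.
  split=> [g0|[y <-]].
    rewrite (augmentation_ker_sum g0); apply: imS => m.
    exact: (imZ (mkmalgU 1%g _ : monoid_ring M)).
  rewrite free_linearE linear_sum big1 // => i _.
  by rewrite linearZ /= augmentation_elt_sub1 scaler0.
have [X XP] := resolution_extending (@regular_projective _)
  (@free_projective _ _) (@aug_linear_surj M) exact0.
exists X; apply: XP.
  exists 1%N, (fun=> 1) => g; exists (fun=> g); rewrite big_ord1.
  by rewrite -[RHS]/(g * 1) mulr1.
exact: free_fg.
Qed.


(** The prefixes of a word in the generators form a path from 1. *)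
Lemma monoid_fg_cayley (M : monoidType) : monoid_fg M ->
  exists2 A : set M, finite_set A & connected_undirected (cayley_digraph M A).
Proof.
move=> [A finA genA]; exists A => //; apply: cayley_connected => m.
have [s sA ->] := genA m; elim/last_ind: s sA => [|s a IH] sA.
  by rewrite big_nil; exact: rst_refl.
rewrite big_rcons /=; apply: rst_trans (cayley_edge _ (sA a _)).
  by apply: IH => b bs; apply: sA; rewrite mem_rcons inE bs orbT.
by rewrite mem_rcons inE eqxx.
Qed.

(** * Continuity at a point *)

Section Continuity.
Variable R : realType.

(** The pasting lemma for the closed sets [a <= c] and [c <= a], localized: each
    function need only be continuous at the points of its own half, which
    matters for formulas that are singular on the other half. *)
Lemma paste_at (T Y : topologicalType) (a : T -> R) (c : R) (f g : T -> Y) x :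
  {for x, continuous a} ->
  (a x <= c -> {for x, continuous f}) -> (c <= a x -> {for x, continuous g}) ->
  (a x = c -> f x = g x) ->
  {for x, continuous (fun t => if a t <= c then f t else g t)}.
Proof.
move=> ca cf cg fg U; rewrite /continuous_at /= => nU.
suff : nbhs x (fun t => U (if a t <= c then f t else g t)) by [].
have nf : a x <= c -> nbhs x (fun t => U (f t)).
  move=> axc; apply: (cf axc); rewrite axc in nU; exact: nU.
have ng : c <= a x -> nbhs x (fun t => U (g t)).
  move=> cax; apply: (cg cax); move: nU; case: (leP (a x) c) => // axc.
  by rewrite fg //; apply/le_anti/andP.
have [ltac|ltca|eac] := ltgtP (a x) c.
- have aU : nbhs x (fun t => a t < c) by exact: (ca _ (lt_nbhsl ltac)).
  by apply: filterS2 aU (nf (ltW ltac)) => t /ltW ->.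
- have aU : nbhs x (fun t => c < a t) by exact: (ca _ (lt_nbhsr ltca)).
  by apply: filterS2 aU (ng (ltW ltca)) => t; rewrite ltNge => /negbTE ->.
- have nfc : nbhs x (fun t => U (f t)) by apply: nf; rewrite eac.
  have ngc : nbhs x (fun t => U (g t)) by apply: ng; rewrite eac.
  by apply: filterS2 nfc ngc => t; case: ifP.
Qed.

Lemma continuous_from_discrete (P : choiceType) (Y : topologicalType)
    (f : discrete_topology P -> Y) : continuous f.
Proof. by apply/continuousP => U _; exact: discrete_open. Qed.

Lemma continuous_discrete_prod (P : choiceType) (K Y : topologicalType)
    (f : discrete_topology P * K -> Y) :
  (forall p, continuous (fun k => f (p, k))) -> continuous f.
Proof.
move=> cf [p k] U /(cf p k) fU; exists ([set p], (fun l => f (p, l)) @^-1` U).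
  by split=> //=; exact: discrete_set1.
by move=> [_ l] /= [-> ].
Qed.

(* The rules below are stated for explicit abstractions, so that they apply to
   functions given by formulas. *)

Section Pointwise.
Variables (T : topologicalType) (x : T).

Lemma cont_eq (Y : topologicalType) (f g : T -> Y) :
  f =1 g -> {for x, continuous g} -> {for x, continuous f}.
Proof. by move=> /funext ->. Qed.

Lemma cont_cst (Y : topologicalType) (c : Y) : {for x, continuous (fun=> c)}.
Proof. exact: cst_continuous. Qed.

Lemma cont_comp (S Y : topologicalType) (f : T -> S) (g : S -> Y) :
  {for x, continuous f} -> {for f x, continuous g} ->
  {for x, continuous (fun t => g (f t))}.
Proof. exact: continuous_comp. Qed.

Lemma cont_compT (S Y : topologicalType) (f : T -> S) (g : S -> Y) :
  {for x, continuous f} -> continuous g ->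
  {for x, continuous (fun t => g (f t))}.
Proof. by move=> cf cg; apply: cont_comp (cg _). Qed.

Lemma cont_pair (S Y : topologicalType) (f : T -> S) (g : T -> Y) :
  {for x, continuous f} -> {for x, continuous g} ->
  {for x, continuous (fun t => (f t, g t))}.
Proof. exact: cvg_pair. Qed.

Implicit Types f g : T -> R.

Lemma contD f g : {for x, continuous f} -> {for x, continuous g} ->
  {for x, continuous (fun t => f t + g t)}.
Proof. exact: (@continuousD _ R). Qed.

Lemma contM f g : {for x, continuous f} -> {for x, continuous g} ->
  {for x, continuous (fun t => f t * g t)}.
Proof. exact: continuousM. Qed.

Lemma contN f : {for x, continuous f} -> {for x, continuous (fun t => - f t)}.
Proof. exact: (@continuousN _ R). Qed.

Lemma cont_sum I (r : seq I) (F : I -> T -> R) :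
  (forall i, {for x, continuous (F i)}) ->
  {for x, continuous (fun t => \sum_(i <- r) F i t)}.
Proof.
move=> cF; elim: r => [|i r IH].
  apply: (@cont_eq _ _ (fun=> 0)); last exact: cont_cst.
  by move=> t; rewrite big_nil.
apply: (@cont_eq _ _ (fun t => F i t + \sum_(j <- r) F j t)); last exact: contD.
by move=> t; rewrite big_cons.
Qed.

Lemma cont_max f g : {for x, continuous f} -> {for x, continuous g} ->
  {for x, continuous (fun t => Num.max (f t) (g t))}.
Proof. exact: continuous_max. Qed.

Lemma cont_min f g : {for x, continuous f} -> {for x, continuous g} ->
  {for x, continuous (fun t => Num.min (f t) (g t))}.
Proof. exact: continuous_min. Qed.

Lemma cont_sqrt f : {for x, continuous f} ->
  {for x, continuous (fun t => Num.sqrt (f t))}.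
Proof. by move=> cf; exact: (cont_compT cf (@sqrt_continuous R)). Qed.

End Pointwise.

Lemma continuous_row (T : topologicalType) n (f : T -> 'rV[R]_n) x :
  (forall i, {for x, continuous (fun t => f t ord0 i)}) -> {for x, continuous f}.
Proof.
move=> cf U [P Pfx PU]; rewrite /nbhs /=.
have : \forall t \near x, forall i, P ord0 i (f t ord0 i).
  by apply: filter_forall => i; apply: cf; exact: Pfx.
by apply: filterS => t Pt; apply: PU => i j; rewrite ord1.
Qed.

Lemma continuous_entry n (i : 'I_n) : continuous (fun y : 'rV[R]_n => y ord0 i).
Proof. exact: coord_continuous. Qed.

Lemma continuous_set_val (T : topologicalType) (A : set T) :
  continuous (set_val : A -> T).
Proof. exact: initial_continuous. Qed.

Lemma continuous_to_set_type (T U : topologicalType) (A : set T) (f : U -> A) x :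
  {for x, continuous (fun u => set_val (f u))} -> {for x, continuous f}.
Proof.
move=> cf V [_ [[B oB <-] /= Bfx BV]]; rewrite /nbhs /=.
have : nbhs x (fun u => B (set_val (f u))).
  by apply: cf; exact: open_nbhs_nbhs.
by apply: filterS => u; exact: BV.
Qed.

End Continuity.

(** * Euclidean balls and spheres *)

Section EuclideanBalls.
Variable R : realType.

Definition sqnorm n (y : 'rV[R]_n) : R := \sum_(i < n) y ord0 i ^+ 2.

Lemma sqnorm_ge0 n (y : 'rV[R]_n) : 0 <= sqnorm y.
Proof. by apply: sumr_ge0 => i _; exact: sqr_ge0. Qed.

Lemma sqnormZ n c (y : 'rV[R]_n) : sqnorm (c *: y) = c ^+ 2 * sqnorm y.
Proof.
by rewrite /sqnorm mulr_sumr; apply: eq_bigr => i _; rewrite mxE exprMn.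
Qed.

Lemma sqnorm_continuous n : continuous (@sqnorm n).
Proof.
move=> y; apply: cont_sum => i.
by apply: contM; exact: continuous_entry.
Qed.

Lemma in_ball n (b : euclidean_ball R n) : sqnorm (set_val b) <= 1.
Proof. exact: (set_valP b). Qed.

Lemma in_sphere n (s : euclidean_sphere R n) : sqnorm (set_val (set_val s)) = 1.
Proof. exact: (set_valP s). Qed.

Lemma ball_inj n : injective (set_val : euclidean_ball R n -> 'rV[R]_n).
Proof. exact: val_inj. Qed.

Lemma sphere_inj n :
  injective (fun s : euclidean_sphere R n => set_val (set_val s)).
Proof. by move=> s t /val_inj/val_inj. Qed.

Definition mk_ball n (y : 'rV[R]_n) (y1 : sqnorm y <= 1) : euclidean_ball R n :=
  exist _ y (mem_set y1).

Fact sphere_subproof n (y : 'rV[R]_n) : sqnorm y = 1 -> sqnorm y <= 1.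
Proof. by move=> ->. Qed.

Definition mk_sphere n (y : 'rV[R]_n) (y1 : sqnorm y = 1) :
    euclidean_sphere R n :=
  exist _ (mk_ball (sphere_subproof y1)) (mem_set y1).

(** The radial retraction onto the ball. As a total continuous function, it
    produces points of the ball from vectors whose norm is bounded only in the
    relevant part of the domain. *)
Definition to_ball_vec n (y : 'rV[R]_n) : 'rV[R]_n :=
  (Num.max 1 (Num.sqrt (sqnorm y)))^-1 *: y.

Fact to_ball_subproof n (y : 'rV[R]_n) : sqnorm (to_ball_vec y) <= 1.
Proof.
rewrite sqnormZ exprVn mulrC ler_pdivrMr ?mul1r; last first.
  by rewrite exprn_gt0 // lt_max ltr01.
rewrite -[leLHS](sqr_sqrtr (sqnorm_ge0 y)) lerXn2r ?nnegrE ?sqrtr_ge0 //.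
  by rewrite le_max ler01.
by rewrite le_max lexx orbT.
Qed.

Definition to_ball n (y : 'rV[R]_n) : euclidean_ball R n :=
  mk_ball (to_ball_subproof y).

Lemma to_ballK n (y : 'rV[R]_n) : sqnorm y <= 1 -> set_val (to_ball y) = y.
Proof.
move=> y1; rewrite -[LHS]/(to_ball_vec y) /to_ball_vec max_l ?invr1 ?scale1r //.
by rewrite -sqrtr1 ler_sqrt.
Qed.

Lemma to_ball_continuous n : continuous (@to_ball n).
Proof.
move=> y; apply: continuous_to_set_type; apply: continuous_row => i.
apply: (@cont_eq _ _ _ _
    (fun z => (Num.max 1 (Num.sqrt (sqnorm z)))^-1 * z ord0 i)).
  by move=> z; rewrite /= /to_ball_vec mxE.
apply: contM; last exact: continuous_entry.
apply: continuousV; first by rewrite gt_eqF // lt_max ltr01.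
by apply: cont_max; [exact: cont_cst|apply: cont_sqrt; exact: sqnorm_continuous].
Qed.

Definition pole n : 'rV[R]_n.+1 := delta_mx ord0 ord0.

Lemma sqnorm_pole n : sqnorm (pole n) = 1.
Proof.
rewrite /sqnorm big_ord_recl mxE !eqxx expr1n big1 ?addr0 // => i _.
by rewrite mxE eqxx expr0n.
Qed.

(** The value at 0 is arbitrary. *)
Definition to_sphere_vec n (y : 'rV[R]_n.+1) : 'rV[R]_n.+1 :=
  if sqnorm y == 0 then pole n else (Num.sqrt (sqnorm y))^-1 *: y.

Fact to_sphere_subproof n (y : 'rV[R]_n.+1) : sqnorm (to_sphere_vec y) = 1.
Proof.
rewrite /to_sphere_vec; case: eqVneq => [_|y0]; first exact: sqnorm_pole.
by rewrite sqnormZ exprVn sqr_sqrtr ?sqnorm_ge0 // mulVf.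
Qed.

Definition to_sphere n (y : 'rV[R]_n.+1) : euclidean_sphere R n.+1 :=
  mk_sphere (to_sphere_subproof y).

Lemma to_sphereE n (y : 'rV[R]_n.+1) : sqnorm y != 0 ->
  set_val (set_val (to_sphere y)) = (Num.sqrt (sqnorm y))^-1 *: y.
Proof.
by move=> /negbTE y0; rewrite -[LHS]/(to_sphere_vec y) /to_sphere_vec y0.
Qed.

Lemma to_sphere_continuous n (y : 'rV[R]_n.+1) : sqnorm y != 0 ->
  {for y, continuous (@to_sphere n)}.
Proof.
move=> y0; do 2 apply: continuous_to_set_type.
have near0 : \forall z \near y, (Num.sqrt (sqnorm z))^-1 *: z =
    set_val (set_val (to_sphere z)).
  have sy : 0 < sqnorm y by rewrite lt_def y0 sqnorm_ge0.
  have : nbhs y (fun z => 0 < sqnorm z).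
    exact: (sqnorm_continuous (lt_nbhsr sy)).
  by apply: filterS => z z0; rewrite to_sphereE ?gt_eqF.
have cn : {for y, continuous (fun z => (Num.sqrt (sqnorm z))^-1 *: z)}.
  apply: continuous_row => i.
  apply: (@cont_eq _ _ _ _ (fun z => (Num.sqrt (sqnorm z))^-1 * z ord0 i)).
    by move=> z; rewrite mxE.
  apply: contM; last exact: continuous_entry.
  apply: continuousV; first by rewrite sqrtr_eq0 -ltNge lt_def y0 sqnorm_ge0.
  by apply: cont_sqrt; exact: sqnorm_continuous.
apply: cvg_trans (near_eq_cvg near0) _.
by rewrite to_sphereE.
Qed.

Lemma sphere_val_continuous n :
  continuous (fun s : euclidean_sphere R n => set_val (set_val s)).
Proof.
move=> s; exact: (cont_comp (@continuous_set_val _ _ s)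
  (@continuous_set_val _ _ (set_val s))).
Qed.

Definition cons_row n (r : R) (y : 'rV[R]_n) : 'rV[R]_n.+1 :=
  \row_j (if unlift ord0 j is Some i then y ord0 i else r).

Definition head_row n (z : 'rV[R]_n.+1) : R := z ord0 ord0.

Definition tail_row n (z : 'rV[R]_n.+1) : 'rV[R]_n :=
  \row_i z ord0 (lift ord0 i).

Lemma head_cons n r (y : 'rV[R]_n) : head_row (cons_row r y) = r.
Proof. by rewrite /head_row mxE unlift_none. Qed.

Lemma tail_cons n r (y : 'rV[R]_n) : tail_row (cons_row r y) = y.
Proof. by apply/rowP => i; rewrite !mxE liftK. Qed.

Lemma sqnorm_head_tail n (z : 'rV[R]_n.+1) :
  sqnorm z = head_row z ^+ 2 + sqnorm (tail_row z).
Proof.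
rewrite /sqnorm big_ord_recl; congr (_ + _); apply: eq_bigr => i _.
by rewrite mxE.
Qed.

Lemma head_continuous n : continuous (@head_row n).
Proof. exact: continuous_entry. Qed.

Lemma tail_continuous n : continuous (@tail_row n).
Proof.
move=> z; apply: continuous_row => i.
apply: (@cont_eq _ _ _ _ (fun t : 'rV[R]_n.+1 => t ord0 (lift ord0 i))).
  by move=> t; rewrite mxE.
exact: continuous_entry.
Qed.

Lemma cons_continuous n (T : topologicalType) (f : T -> R) (g : T -> 'rV[R]_n) x :
  {for x, continuous f} -> {for x, continuous g} ->
  {for x, continuous (fun t => cons_row (f t) (g t))}.
Proof.
move=> cf cg; apply: continuous_row => i.
apply: (@cont_eq _ _ _ _
  (fun t => if unlift ord0 i is Some j then g t ord0 j else f t)).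
  by move=> t; rewrite mxE.
by case: unliftP => [j _|//]; exact: (cont_compT cg (@continuous_entry R _ j)).
Qed.

Lemma cont_scale n (T : topologicalType) (f : T -> R) (g : T -> 'rV[R]_n) x :
  {for x, continuous f} -> {for x, continuous g} ->
  {for x, continuous (fun t => f t *: g t)}.
Proof.
move=> cf cg; apply: continuous_row => i.
apply: (@cont_eq _ _ _ _ (fun t => f t * g t ord0 i)).
  by move=> t; rewrite mxE.
exact: (contM cf (cont_compT cg (@continuous_entry R _ i))).
Qed.

(** The affine map from [0, 1] to [-1, 1], extended by constants. *)
Definition clamp (t : R) : R := Num.max (-1) (Num.min 1 (2 * t - 1)).

Lemma clamp_continuous : continuous clamp.
Proof.
move=> t; have c (r : R) := @cont_cst R t R r.
apply: (@cont_max R R t (fun=> -1) (fun t => Num.min 1 (2 * t - 1)) (c _)).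
apply: (@cont_min R R t (fun=> 1) (fun t => 2 * t - 1) (c _)).
have ct : {for t, continuous (fun u : R => u)} by [].
exact: (@contD R R t _ _ (@contM R R t _ _ (c 2) ct) (c (- 1))).
Qed.

Lemma clamp_le t : t <= 0 -> clamp t = -1.
Proof. by move=> t0; rewrite /clamp min_r ?max_l //; lra. Qed.

Lemma clamp_ge t : 1 <= t -> clamp t = 1.
Proof. by move=> t1; rewrite /clamp min_l ?max_r //; lra. Qed.

Lemma clamp_mid t : 0 <= t <= 1 -> clamp t = 2 * t - 1.
Proof. by move=> /andP[t0 t1]; rewrite /clamp min_r ?max_r //; lra. Qed.

Lemma clamp_sqr t : clamp t ^+ 2 <= 1.
Proof.
have [t0|t0] := leP t 0; first by rewrite clamp_le // sqrrN expr1n.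
have [t1|t1] := leP 1 t; first by rewrite clamp_ge // expr1n.
rewrite clamp_mid ?ltW //; nra.
Qed.

(** The map from the cylinder over the ball, with height [c] in [-1, 1], to
    the ball of the next dimension that shrinks both coordinates: by
    [sqnorm_squircle] it maps the boundary of the cylinder, and nothing else,
    to the sphere, and it is given without division. Any positive numbers with
    sum 1 could replace 9/25 and 16/25; these two are squares, so that the
    rims of the cylinder go to the rational heights -3/5 and 3/5. *)
Definition squircle n (b : 'rV[R]_n) (c : R) : 'rV[R]_n.+1 :=
  cons_row (c * Num.sqrt (1 - 16 / 25 * sqnorm b))
    (Num.sqrt (1 - 9 / 25 * c ^+ 2) *: b).

Lemma sqnorm_squircle n (b : 'rV[R]_n) c : sqnorm b <= 1 -> c ^+ 2 <= 1 ->
  sqnorm (squircle b c) = 1 - (1 - sqnorm b) * (1 - c ^+ 2).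
Proof.
move=> b1 c1; rewrite sqnorm_head_tail head_cons tail_cons sqnormZ exprMn.
by rewrite !sqr_sqrtr; [field|lra|lra].
Qed.

Lemma squircle_continuous n (T : topologicalType) (f : T -> 'rV[R]_n)
    (g : T -> R) x :
  {for x, continuous f} -> {for x, continuous g} ->
  {for x, continuous (fun t => squircle (f t) (g t))}.
Proof.
move=> cf cg; apply: cons_continuous.
  apply: contM => //; apply: cont_sqrt; apply: contD; first exact: cont_cst.
  apply: contN; apply: contM; first exact: cont_cst.
  exact: (cont_compT cf (@sqnorm_continuous n)).
apply: cont_scale => //; apply: cont_sqrt; apply: contD; first exact: cont_cst.
apply: contN; apply: contM; first exact: cont_cst.
exact: contM.
Qed.

(** * Extending a homotopy over a cell *)

(** A map on the boundary of the cylinder over a ball, equal to [k] on the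
    bottom, [g] on the side and [y0] on the top, extends to the cylinder after
    composition with [j], as soon as all maps on the sphere extend to the ball
    after this composition. The boundary of the cylinder is identified with a
    sphere by [squircle], whose inverse on the sphere is a formula on each of
    the zones below -3/5, between -3/5 and 3/5, and above 3/5; [f] is the given
    map read through this inverse, and the extension of [f] to the ball is
    composed with [squircle]. Time ranges over all reals, the homotopies being
    constant outside [0, 1]. *)
Lemma homotopy_fill n (Y Z : topologicalType) (j : Y -> Z)
    (k : euclidean_ball R n.+1 -> Y) (g : euclidean_sphere R n.+1 -> R -> Y)
    (y0 : Y) :
  continuous k -> continuous (uncurry g) ->
  (forall s t, t <= 0 -> g s t = k (set_val s)) ->
  (forall s t, 1 <= t -> g s t = y0) ->
  (forall f : euclidean_sphere R n.+2 -> Y, continuous f ->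
     exists F : euclidean_ball R n.+2 -> Z,
       continuous F /\ forall s, F (set_val s) = j (f s)) ->
  exists G : euclidean_ball R n.+1 -> R -> Z,
    [/\ continuous (uncurry G),
        forall b t, t <= 0 -> G b t = j (k b),
        forall b t, 1 <= t -> G b t = j y0 &
        forall s t, G (set_val s) t = j (g s t)].
Proof.
move=> ck cg g0 g1 fill.
pose hd (z : euclidean_sphere R n.+2) := head_row (set_val (set_val z)).
pose tl (z : euclidean_sphere R n.+2) := tail_row (set_val (set_val z)).
have chd : continuous hd.
  by move=> z; exact: (cont_compT (@sphere_val_continuous _ z) (@head_continuous _)).
have ctl : continuous tl.
  by move=> z; exact: (cont_compT (@sphere_val_continuous _ z) (@tail_continuous _)).
have sq z : hd z ^+ 2 + sqnorm (tl z) = 1.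
  by rewrite -sqnorm_head_tail in_sphere.
(* At height [r] in the middle zone, the sphere meets the image of the side of
   the cylinder at height [5/3 r], that is, at time [(1 + 5/3 r) / 2]. *)
pose side z := g (to_sphere (tl z)) ((1 + 5 / 3 * hd z) / 2).
pose f z := if hd z <= - (3 / 5) then k (to_ball ((5 / 4) *: tl z)) else
  if hd z <= 3 / 5 then side z else y0.
have cf : continuous f.
  move=> z; apply: paste_at; first exact: chd.
  - move=> _; apply: cont_comp; last exact: ck.
    apply: cont_comp; last exact: to_ball_continuous.
    by apply: cont_scale; [exact: cont_cst|exact: ctl].
  - move=> hz; apply: paste_at; first exact: chd.
    + move=> zh; have tz : sqnorm (tl z) != 0.
        by have := sq z; apply: contraPneq => ->; nra.
      apply: (@cont_comp _ _ _ _
        (fun z => (to_sphere (tl z), (1 + 5 / 3 * hd z) / 2)) (uncurry g)).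
        apply: cont_pair.
          exact: (cont_comp (ctl z) (to_sphere_continuous tz)).
        apply: contM; last exact: cont_cst.
        apply: contD; first exact: cont_cst.
        by apply: contM; [exact: cont_cst|exact: chd].
      exact: cg.
    + by move=> _; exact: cont_cst.
    + move=> hz'; rewrite /side g1 // hz'; lra.
  (* On the rim between bottom and side, the norm of the tail is 4/5. *)
  - move=> hz; rewrite hz ifT; last lra.
    rewrite /side g0 ?hz; last lra.
    congr k; apply: ball_inj.
    have tz : sqnorm (tl z) = (4 / 5) ^+ 2 by have := sq z; rewrite hz; lra.
    rewrite to_sphereE; last by rewrite tz; lra.
    rewrite to_ballK; last by rewrite sqnormZ tz; lra.
    by rewrite tz sqrtr_sqr ger0_norm; [congr (_ *: _); field | lra].
have [F [cF Ff]] := fill f cf.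
have phi_ball (b : euclidean_ball R n.+1) t :
    sqnorm (squircle (set_val b) (clamp t)) <= 1.
  rewrite sqnorm_squircle ?in_ball ?clamp_sqr //.
  by rewrite gerBl mulr_ge0 // subr_ge0 ?in_ball ?clamp_sqr.
pose G b t := F (mk_ball (phi_ball b t)).
have Gf b t (z1 : sqnorm (squircle (set_val b) (clamp t)) = 1) :
    G b t = j (f (mk_sphere z1)).
  by rewrite -Ff; congr F; exact: ball_inj.
have sphere_caps (b : euclidean_ball R n.+1) t : clamp t ^+ 2 = 1 ->
    sqnorm (squircle (set_val b) (clamp t)) = 1.
  by move=> c1; rewrite sqnorm_squircle ?in_ball ?clamp_sqr // c1 subrr mulr0 subr0.
have hdE b t (z1 : sqnorm (squircle (set_val b) (clamp t)) = 1) :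
    hd (mk_sphere z1) = clamp t * Num.sqrt (1 - 16 / 25 * sqnorm (set_val b)).
  exact: head_cons.
have tlE b t (z1 : sqnorm (squircle (set_val b) (clamp t)) = 1) :
    tl (mk_sphere z1) = Num.sqrt (1 - 9 / 25 * clamp t ^+ 2) *: set_val b.
  exact: tail_cons.
have cap_ge (b : euclidean_ball R n.+1) :
    3 / 5 <= Num.sqrt (1 - 16 / 25 * sqnorm (set_val b)) :> R.
  have : 0 <= 3 / 5 :> R by lra.
  move=> /ger0_norm <-; rewrite -sqrtr_sqr ler_wsqrtr //.
  by have := in_ball b; lra.
have r45 : Num.sqrt (1 - 9 / 25) = 4 / 5 :> R.
  have -> : 1 - 9 / 25 = (4 / 5) ^+ 2 :> R by field.
  by rewrite sqrtr_sqr ger0_norm //; lra.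
have G0 b t : t <= 0 -> G b t = j (k b).
  move=> t0; have c1 := clamp_le t0.
  have z1 : sqnorm (squircle (set_val b) (clamp t)) = 1.
    by apply: sphere_caps; rewrite c1 sqrrN expr1n.
  rewrite (Gf _ _ z1) /f /side hdE tlE c1 mulN1r lerN2 cap_ge; congr (j (k _)).
  apply: ball_inj; rewrite sqrrN expr1n mulr1 r45 scalerA.
  by rewrite (_ : 5 / 4 * (4 / 5) = 1) ?scale1r ?to_ballK ?in_ball //; field.
have G1 b t : 1 <= t -> G b t = j y0.
  move=> t1; have c1 := clamp_ge t1.
  have z1 : sqnorm (squircle (set_val b) (clamp t)) = 1.
    by apply: sphere_caps; rewrite c1 expr1n.
  rewrite (Gf _ _ z1) /f /side hdE tlE c1 mul1r; have := cap_ge b.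
  set h := Num.sqrt _ => h35; rewrite ifF; last by apply/negbTE; lra.
  by case: leP => // hle; rewrite g1 //; lra.
exists G; split => //.
  move=> [b t].
  apply: (@cont_eq _ _ _ _ (fun bt : _ * _ => G bt.1 bt.2)); first by case.
  apply: (@cont_comp _ _ _ _
    (fun bt : euclidean_ball R n.+1 * R => mk_ball (phi_ball bt.1 bt.2)) F).
    apply: continuous_to_set_type; apply: squircle_continuous.
      exact: (cont_compT cvg_fst (@continuous_set_val _ _)).
    exact: (cont_compT cvg_snd clamp_continuous).
  exact: cF.
move=> s t; have [t0|t0] := leP t 0; first by rewrite G0 // g0.
have [t1|t1] := leP 1 t; first by rewrite G1 // g1.
have c1 : clamp t = 2 * t - 1 by apply: clamp_mid; lra.
have z1 : sqnorm (squircle (set_val (set_val s)) (clamp t)) = 1.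
  by rewrite sqnorm_squircle ?in_sphere ?clamp_sqr // subrr mul0r subr0.
rewrite (Gf _ _ z1) /f /side hdE tlE in_sphere mulr1.
have -> : Num.sqrt (1 - 16 / 25) = 3 / 5 :> R.
  have -> : 1 - 16 / 25 = (3 / 5) ^+ 2 :> R by field.
  by rewrite sqrtr_sqr ger0_norm //; lra.
rewrite c1 ifF; last by apply/negbTE; lra.
rewrite ifT; last by lra.
have al0 : 0 < Num.sqrt (1 - 9 / 25 * (2 * t - 1) ^+ 2).
  by rewrite sqrtr_gt0; nra.
congr (j (g _ _)); last by field.
apply: sphere_inj; rewrite to_sphereE sqnormZ in_sphere mulr1.
  by rewrite sqrtr_sqr gtr0_norm // scalerA mulVf ?scale1r // gt_eqF.
by rewrite gt_eqF // exprn_gt0.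
Qed.

End EuclideanBalls.

(** * Final topologies *)

Section FinalTopology.
Variables (I : Type) (T : I -> topologicalType) (X : choiceType).
Variable f : forall i, T i -> X.

Definition final_topology & (forall i, T i -> X) : Type := X.
Local Notation W := (final_topology f).

HB.instance Definition _ := Choice.on W.

Definition final_open (U : set W) : Prop := forall i, open (@f i @^-1` U).

Fact final_openT : final_open setT.
Proof. by move=> i; rewrite preimage_setT; exact: openT. Qed.

Fact final_openI : setI_closed final_open.
Proof. by move=> U V oU oV i; rewrite preimage_setI; exact: openI. Qed.

Fact final_open_bigU (J : Type) (g : J -> set W) :
  (forall j, final_open (g j)) -> final_open (\bigcup_j g j).
Proof.
move=> og i; rewrite preimage_bigcup; apply: bigcup_open => j _.
exact: og.
Qed.

HB.instance Definition _ :=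
  isOpenTopological.Build W final_openT final_openI final_open_bigU.

Lemma final_openE (U : set W) : open U = final_open U.
Proof. by []. Qed.

Lemma final_map_continuous i : continuous (@f i : T i -> W).
Proof. by apply/continuousP => U; rewrite final_openE. Qed.

Lemma final_continuous (Y : topologicalType) (g : W -> Y) :
  (forall i, continuous (fun x => g (@f i x))) -> continuous g.
Proof.
move=> cg; apply/continuousP => U oU; rewrite final_openE => i.
by have /continuousP := cg i; exact.
Qed.

(** A product with the real line carries the final topology as well: curry
    [g] into a function to a space of paths with the compact-open topology,
    and use that the real line is locally compact to uncurry. *)
Lemma final_uncurry_continuous (R : realType) (Y : topologicalType)
    (g : W -> R -> Y) :
  (forall x, exists i y, @f i y = x) ->
  (forall i, continuous (uncurry (fun x => g (@f i x)))) ->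
  continuous (uncurry g).
Proof.
move=> fsurj cg; apply: continuous_uncurry.
- exact: locally_compactR.
- exact: Rhausdorff.
- apply: (@final_continuous {compact-open, R -> Y} g) => i.
  by have [+ _] := continuous_curry (cg i).
- move=> x; have [i [y <-]] := fsurj x.
  have [_] := continuous_curry (cg i); exact.
Qed.

End FinalTopology.

Lemma continuous_uncurry_discrete_prod (P : choiceType)
    (K L Y : topologicalType) (f : discrete_topology P * K -> L -> Y) :
  (forall p, continuous (uncurry (fun k => f (p, k)))) -> continuous (uncurry f).
Proof.
move=> cf [[p k] l] U /(cf p (k, l)) [[V W] /= [Vk Wl] VWU].
exists ([set p] `*` V, W) => /=.
  by split=> //; exists ([set p], V) => //=; split=> //; exact: discrete_set1.
by move=> [[_ k'] l'] /= [[-> Vk'] Wl']; exact: (VWU (k', l')).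
Qed.

(** * Spaces with an action, and free sets *)

Section MSpaces.
Variable M : monoidType.

Section Build.
Variables (X : topologicalType) (act : M -> X -> X).
Hypothesis act1 : forall x, act 1%g x = x.
Hypothesis actM : forall a b x, act (a * b)%g x = act a (act b x).
Hypothesis act_continuous : forall m, continuous (act m).

Fact mspace_of_continuous :
  continuous (fun mx : discrete_topology M * X => act mx.1 mx.2).
Proof. exact: continuous_discrete_prod. Qed.

Definition mspace_of : mspace M := MSpace act1 actM mspace_of_continuous.
End Build.

Lemma tact_cont (X : mspace M) m : continuous (@tact M X m).
Proof.
move=> x; apply: (@cont_comp _ _ _ _ (fun y => (m : discrete_topology M, y))
  (fun mx : discrete_topology M * X => tact mx.1 mx.2)).
  by apply: cont_pair; [exact: cont_cst|].
exact: tact_continuous.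
Qed.

Section FreeMSet.
Variable S : choiceType.

Let act (m : M) (x : M * S) : M * S := ((m * x.1)%g, x.2).

Fact free_act1 x : act 1%g x = x.
Proof. by case: x => m s; rewrite /act mul1g. Qed.

Fact free_actM a b x : act (a * b)%g x = act a (act b x).
Proof. by rewrite /act mulgA. Qed.

Definition free_mset : mset M := MSet free_act1 free_actM.

Lemma free_mset_projective : mset_projective free_mset.
Proof.
move=> Q f feq fsurj; have [q fq] := choice (fun s : S => fsurj (1%g, s)).
exists (fun x => sact x.1 (q x.2)); split=> [m x|[m s]].
  by rewrite /= sactM.
by rewrite feq fq /= /act mulg1.
Qed.

Lemma free_mset_fg (s : seq S) : (forall x, x \in s) -> mset_fg free_mset.
Proof.
move=> sT; exists [seq (1%g, x) | x <- s] => -[m x].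
exists m; exists (1%g, x); first by apply/mapP; exists x.
by rewrite /= /act mulg1.
Qed.
End FreeMSet.
End MSpaces.

(** * Attaching cells *)

Section Attach.
Variables (R : realType) (M : monoidType) (d : nat) (X : mspace M) (C : mset M).
Variable att : mprod C (euclidean_sphere R d) -> X.

Local Notation ball := (euclidean_ball R d).
Local Notation sphere := (euclidean_sphere R d).
Local Notation carrier := (X + C * (~` sphere : set ball))%type.

(** The underlying set of the space with the cells attached is the disjoint
    union of [X] and of the open cells, so that no quotient is taken; only the
    topology sees the attaching map. *)
Definition char_map (x : mprod C ball) : carrier :=
  match pselect (sphere x.2) with
  | left s => inl (att (x.1, exist _ x.2 (mem_set s)))
  | right ns => inr (x.1, exist _ x.2 (mem_set ns))
  end.

Lemma char_map_sphere c (s : sphere) : char_map (c, set_val s) = inl (att (c, s)).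
Proof.
rewrite /char_map; case: pselect => /= [h|[]]; last exact: set_valP.
by congr (inl (att (_, _))); exact: val_inj.
Qed.

Lemma char_map_interior c (b : (~` sphere : set ball)) :
  char_map (c, set_val b) = inr (c, b).
Proof.
rewrite /char_map; case: pselect => /= h; first by case: (set_valP b).
by congr (inr (_, _)); exact: val_inj.
Qed.

Definition attach_piece (i : bool) : topologicalType :=
  if i then X else mprod C ball.

Definition attach_incl (i : bool) : attach_piece i -> carrier :=
  if i return attach_piece i -> carrier then inl else char_map.

Definition attach_space : topologicalType := final_topology attach_incl.

Lemma attach_incl_surj (x : attach_space) : exists i y, attach_incl (i := i) y = x.
Proof.
case: x => [x|[c b]]; first by exists true, x.
by exists false, (c, set_val b); exact: char_map_interior.
Qed.

Lemma inl_continuous : continuous (inl : X -> attach_space).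
Proof. exact: (@final_map_continuous _ _ _ attach_incl true). Qed.

Lemma char_map_continuous : continuous (char_map : mprod C ball -> attach_space).
Proof. exact: (@final_map_continuous _ _ _ attach_incl false). Qed.

Lemma attach_continuous (Y : topologicalType) (g : attach_space -> Y) :
  continuous (fun x : X => g (inl x)) -> continuous (fun x => g (char_map x)) ->
  continuous g.
Proof. by move=> cX cC; apply: final_continuous => -[]. Qed.

Lemma attach_uncurry_continuous (Y : topologicalType)
    (g : attach_space -> R -> Y) :
  continuous (uncurry (fun x : X => g (inl x))) ->
  (forall c, continuous (uncurry (fun b : ball => g (char_map (c, b))))) ->
  continuous (uncurry g).
Proof.
move=> cX cC; apply: final_uncurry_continuous; first exact: attach_incl_surj.
by case=> //=; exact: continuous_uncurry_discrete_prod.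
Qed.

Hypothesis att_equiv : forall m x, att (tact m x) = tact m (att x).

Definition attach_act (m : M) (x : attach_space) : attach_space :=
  match x with
  | inl x => inl (tact m x)
  | inr cb => inr (sact m cb.1, cb.2)
  end.

Lemma attach_act_char m x :
  attach_act m (char_map x) = char_map (tact m x).
Proof.
rewrite /char_map /=; case: x => c b /=; case: pselect => //= s.
by rewrite -att_equiv.
Qed.

Fact attach_act1 x : attach_act 1%g x = x.
Proof. by case: x => [x|[c b]] /=; rewrite ?tact1 ?sact1. Qed.

Fact attach_actM a b x : attach_act (a * b)%g x = attach_act a (attach_act b x).
Proof. by case: x => [x|[c e]] /=; rewrite ?tactM ?sactM. Qed.

Fact attach_act_continuous m : continuous (attach_act m).
Proof.
apply: attach_continuous => x.
  exact: (cont_comp (@tact_cont _ X m x) (@inl_continuous _)).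
apply: (@cont_eq (mprod C ball) x attach_space _ (fun x => char_map (tact m x))).
  by move=> y; rewrite attach_act_char.
exact: (cont_comp (@tact_cont _ (mprod C ball) m x) (@char_map_continuous _)).
Qed.

Definition attach : mspace M :=
  mspace_of attach_act1 attach_actM attach_act_continuous.

Hypothesis att_continuous : continuous att.

(** The map out of the pushout is forced on [X] and on the open cells; that it
    agrees with [u] on the closed cells is the compatibility hypothesis. *)
Lemma attach_pushout :
  @is_mpushout M (mprod C sphere) (mprod C ball) X attach
    (fun x => (x.1, set_val x.2)) att char_map inl.
Proof.
split.
- split.
  + split=> //; apply: continuous_discrete_prod => c s.
    apply: (@cont_pair _ _ _ _ (fun=> c : discrete_topology C) set_val).
      exact: cont_cst.
    exact: continuous_set_val.
  + by [].
  + by split=> [|m x]; [exact: char_map_continuous|rewrite -attach_act_char].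
  + by split=> [|m x]; [exact: inl_continuous|].
- by case=> c s; exact: char_map_sphere.
move=> Y u v [cu eu] [cv ev] uv.
pose w (x : attach) : Y :=
  match x with inl x => v x | inr cb => u (cb.1, set_val cb.2) end.
have w_char x : w (char_map x) = u x.
  rewrite /w /char_map; case: x => c b /=; case: pselect => //= s.
  by rewrite -uv.
exists w; split.
  split=> //; split.
    apply: attach_continuous => //.
    by under eq_fun do rewrite w_char.
  move=> m [x|[c b]]; first exact: ev.
  by rewrite /= -eu.
move=> w' [_ w'_char w'_inl]; apply/funext => -[x|[c b]] //.
by rewrite -char_map_interior w'_char.
Qed.

End Attach.

(** * Sequential colimits *)

Section SequentialColimit.
Variables (M : monoidType) (Xs : nat -> mspace M).
Variable i : forall n, Xs n -> Xs n.+1.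
Hypothesis i_mmap : forall n, is_mmap (@i n).

Local Notation stages := {n : nat & Xs n}.

Definition colim_step (z : stages) : stages :=
  existT _ (tag z).+1 (i (tagged z)).

(** Two elements of two stages become equal at a later stage. Counting the steps
    from both of them avoids any transport between equal indices. *)
Definition colim_rel (y z : stages) : bool :=
  `[< exists a b, iter a colim_step y = iter b colim_step z >].

Fact colim_rel_refl : reflexive colim_rel.
Proof. by move=> z; apply/asboolP; exists 0%N, 0%N. Qed.

Fact colim_rel_sym : symmetric colim_rel.
Proof.
by move=> y z; apply/asboolP/asboolP => -[a [b e]]; exists b, a.
Qed.

Fact colim_rel_trans : transitive colim_rel.
Proof.
move=> y x z /asboolP[a [b xy]] /asboolP[c [d yz]]; apply/asboolP.
by exists (c + a)%N, (b + d)%N; rewrite !iterD xy -yz -!iterD addnC.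
Qed.

Canonical colim_equiv :=
  EquivRel colim_rel colim_rel_refl colim_rel_sym colim_rel_trans.

Local Open Scope quotient_scope.

Definition colim_carrier := {eq_quot colim_rel}.

Definition colim_in n (x : Xs n) : colim_carrier :=
  \pi_(colim_carrier) (existT _ n x).

Definition colim_space : topologicalType := final_topology colim_in.

Lemma colim_in_continuous n : continuous (colim_in (n := n) : Xs n -> colim_space).
Proof. exact: (@final_map_continuous _ _ _ colim_in n). Qed.

Lemma colim_in_surj (z : colim_space) : exists n x, colim_in (n := n) x = z.
Proof.
by elim/quotW: z => -[n x]; exists n, x.
Qed.

Lemma colim_in_step n (x : Xs n) : colim_in (i x) = colim_in x.
Proof. by apply/eqquotP/asboolP; exists 0%N, 1%N. Qed.

Definition colim_lift (Y : Type) (u : forall n, Xs n -> Y) (z : colim_space) : Y :=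
  u _ (tagged (repr (z : colim_carrier))).

Lemma colim_liftE (Y : Type) (u : forall n, Xs n -> Y) :
  (forall n x, u n.+1 (i x) = u n x) ->
  forall n x, colim_lift u (colim_in x) = u n x.
Proof.
move=> u_i n x; pose us (z : stages) := u _ (tagged z).
have us_iter a z : us (iter a colim_step z) = us z.
  by elim: a => //= a IH; rewrite -[RHS]IH; exact: u_i.
have /eqquotP/asboolP[a [b e]] :
    repr (colim_in x) = existT _ n x %[mod colim_carrier] by rewrite reprK.
by rewrite -[RHS](us_iter b (existT _ n x)) -e us_iter.
Qed.

Definition colim_act (m : M) : colim_space -> colim_space :=
  colim_lift (fun n x => colim_in (tact m x)).

Lemma colim_actE m n (x : Xs n) : colim_act m (colim_in x) = colim_in (tact m x).
Proof.
apply: (colim_liftE (u := fun n x => colim_in (tact m x))) => {}n {}x.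
by rewrite -(i_mmap n).2 colim_in_step.
Qed.

Fact colim_act1 z : colim_act 1%g z = z.
Proof. by have [n [x <-]] := colim_in_surj z; rewrite colim_actE tact1. Qed.

Fact colim_actM a b z : colim_act (a * b)%g z = colim_act a (colim_act b z).
Proof. by have [n [x <-]] := colim_in_surj z; rewrite !colim_actE tactM. Qed.

Fact colim_act_continuous m : continuous (colim_act m).
Proof.
apply: final_continuous => n x.
apply: (@cont_eq _ _ colim_space _ (fun x => colim_in (tact m x))).
  by move=> y; exact: colim_actE.
exact: (cont_comp (@tact_cont _ _ m x) (@colim_in_continuous _ _)).
Qed.

Definition colim : mspace M :=
  mspace_of colim_act1 colim_actM colim_act_continuous.

Lemma colim_universal : @is_msequential_colimit M Xs i colim colim_in.
Proof.
split=> //.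
- by move=> n; split=> [|m x]; [exact: colim_in_continuous|rewrite -colim_actE].
- exact: colim_in_step.
move=> Y u u_mmap u_i; exists (colim_lift u); split.
  split; last exact: colim_liftE.
  split.
    apply: final_continuous => n x.
    apply: (@cont_eq _ _ Y _ (u n)); last exact: (u_mmap n).1.
    exact: colim_liftE.
  move=> m z; have [n [x <-]] := colim_in_surj z.
  by rewrite [tact m _]colim_actE !colim_liftE // (u_mmap n).2.
move=> w [_ wE]; apply/funext => z; have [n [x <-]] := colim_in_surj z.
by rewrite colim_liftE.
Qed.

Lemma colim_homotopy (R : realType) (Y : topologicalType)
    (h : forall n, Xs n -> R -> Y) :
  (forall n, continuous (uncurry (@h n))) ->
  (forall n x, @h n.+1 (i x) = @h n x) ->
  exists H : colim * R -> Y,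
    continuous H /\ forall n (x : Xs n) t, H (colim_in x, t) = h n x t.
Proof.
move=> ch hi; exists (uncurry (colim_lift h)); split; last first.
  by move=> n x t; rewrite /= colim_liftE.
apply: final_uncurry_continuous; first exact: colim_in_surj.
move=> n; rewrite (_ : (fun x => _) = @h n); first exact: ch.
by apply/funext => x; exact: (colim_liftE (u := h)).
Qed.

End SequentialColimit.

(** * Paths and sequences *)

Section Paths.
Variables (R : realType) (Y : topologicalType).

(** Paths are parametrized by the real line and constant outside [0, 1]. *)
Definition joined (y y' : Y) : Prop := exists p : R -> Y,
  [/\ continuous p, forall t, t <= 0 -> p t = y & forall t, 1 <= t -> p t = y'].

Lemma joined_refl y : joined y y.
Proof. by exists (fun=> y); split => //; exact: cst_continuous. Qed.

Lemma joined_sym y y' : joined y y' -> joined y' y.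
Proof.
move=> [p [cp p0 p1]]; exists (fun t => p (1 - t)); split=> [t|t t0|t t1].
- apply: (@cont_comp R t R _ (fun t => 1 - t) p); last exact: cp.
  apply: (@contD R R t (fun=> 1) (fun t => - t)); first exact: cont_cst.
  by apply: (@contN R R t (fun t => t)).
- by apply: p1; lra.
- by apply: p0; lra.
Qed.

Lemma joined_trans y y' y'' : joined y y' -> joined y' y'' -> joined y y''.
Proof.
move=> [p [cp p0 p1]] [q [cq q0 q1]].
have cid (t : R) : {for t, continuous (fun u : R => u)} by [].
have cdouble (t : R) : {for t, continuous (fun u : R => 2 * u)}.
  by apply: (@contM R R t (fun=> 2) (fun t => t)); [exact: cont_cst|].
exists (fun t => if t <= 1 / 2 then p (2 * t) else q (2 * t - 1)); split.
- move=> t; apply: (@paste_at R R Y (fun t => t) (1 / 2)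
    (fun t => p (2 * t)) (fun t => q (2 * t - 1))) => //.
  + by move=> _; apply: (@cont_comp R t R _ (fun t => 2 * t) p); last exact: cp.
  + move=> _; apply: (@cont_comp R t R _ (fun t => 2 * t - 1) q); last exact: cq.
    by apply: (@contD R R t (fun t => 2 * t) (fun=> - 1)); last exact: cont_cst.
  + by move=> ->; rewrite p1 ?q0 //; lra.
- by move=> t t0; rewrite ifT ?p0 //; lra.
- by move=> t t1; rewrite ifF ?q1 //; [lra|apply/negbTE; lra].
Qed.

End Paths.

Lemma dependent_sequence (T : nat -> Type) (P : forall n, T n -> Prop)
    (Q : forall n, T n -> T n.+1 -> Prop) (x0 : T 0%N) :
  P 0%N x0 ->
  (forall n x, P n x -> exists2 y, P n.+1 y & Q n x y) ->
  exists s : forall n, T n,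
    [/\ s 0%N = x0, forall n, P n (s n) & forall n, Q n (s n) (s n.+1)].
Proof.
move=> Px0 step.
have succ n (x : {x | P n x}) : {y : {y | P n.+1 y} | Q n (sval x) (sval y)}.
  have /cid2[y Py Qy] := step n _ (svalP x).
  by exists (exist _ y Py).
pose s := fix s n : {x | P n x} :=
  if n is n'.+1 then sval (succ n' (s n')) else exist _ x0 Px0.
exists (fun n => sval (s n)); split=> [//|n|n]; first exact: svalP.
exact: (svalP (succ n (s n))).
Qed.

(** * A contractible complex with prescribed 1-cells *)

Section Construction.
Variables (R : realType) (M : monoidType) (A : set M).

(** The base point serves to name the ends of the 1-cells. *)
Record based_mspace := BasedMSpace {
  based_sort :> mspace M;
  base : based_sort
}.

Arguments base : clear implicits.

(** The 0-sphere, mapped to the ends of the edge from [1] to [a]: its two points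
    have coordinates -1 and 1. *)
Definition edge_ends (X : based_mspace) (a : M) (s : euclidean_sphere R 1) : X :=
  if (set_val (set_val s) : 'rV[R]_1) ord0 ord0 <= 0 then base X
  else tact a (base X).

Lemma edge_ends_continuous X a : continuous (edge_ends X a).
Proof.
move=> s; apply: (@paste_at R _ X
    (fun s : euclidean_sphere R 1 => (set_val (set_val s) : 'rV[R]_1) ord0 ord0)
    0 (fun=> base X) (fun=> tact a (base X))).
- exact: (cont_compT (@sphere_val_continuous R 1 s) (@continuous_entry R _ ord0)).
- by move=> _; exact: cont_cst.
- by move=> _; exact: cont_cst.
move=> s0; have := in_sphere s.
by rewrite /sqnorm big_ord1 s0 expr0n /= => /eqP; rewrite eq_sym oner_eq0.
Qed.

(** The maps of n-spheres along which (n+1)-cells are attached. *)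
Definition sphere_family n (X : based_mspace) :
    set (euclidean_sphere R n.+1 -> X) :=
  match n with
  | 0 => [set edge_ends X a | a in A]
  | _.+1 => [set f | continuous f]
  end.

Lemma sphere_family_continuous n X f : @sphere_family n X f -> continuous f.
Proof. by case: n f => [|n] f //= [a _ <-]; exact: edge_ends_continuous. Qed.

Definition new_cells n (X : based_mspace) : mset M :=
  free_mset M (@sphere_family n X).

Definition new_attaching n X
    (x : mprod (new_cells n X) (euclidean_sphere R n.+1)) : X :=
  tact x.1.1 (set_val x.1.2 x.2).

Lemma new_attaching_equiv n X m x :
  @new_attaching n X (tact m x) = tact m (new_attaching x).
Proof. exact: tactM. Qed.

Lemma new_attaching_continuous n X : continuous (@new_attaching n X).
Proof.
apply: continuous_discrete_prod => -[m f] s.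
apply: (@cont_comp _ _ _ _ (set_val f) (@tact M X m)); last exact: tact_cont.
exact: (sphere_family_continuous (set_valP f)).
Qed.

Definition next_stage n (X : based_mspace) : based_mspace :=
  @BasedMSpace (attach (@new_attaching_equiv n X)) (inl (base X)).

Definition stage_incl n (X : based_mspace) (x : X) : next_stage n X := inl x.

Definition stage_char n (X : based_mspace)
    (x : mprod (new_cells n X) (euclidean_ball R n.+1)) : next_stage n X :=
  char_map (@new_attaching n X) x.

Lemma stage_incl_continuous n X : continuous (@stage_incl n X).
Proof. exact: inl_continuous. Qed.

Lemma stage_char_continuous n X : continuous (@stage_char n X).
Proof. exact: char_map_continuous. Qed.

Lemma stage_char_cell_continuous n X c :
  continuous (fun b => @stage_char n X (c, b)).
Proof.
move=> b; apply: (@cont_comp _ b _ _ (fun b => (c : discrete_topology _, b))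
  (@stage_char n X)); last exact: stage_char_continuous.
by apply: cont_pair; [exact: cont_cst|].
Qed.

Lemma stage_char_sphere n (X : based_mspace) c s :
  stage_char (c, set_val s) = stage_incl n (X := X) (new_attaching (c, s)).
Proof. exact: char_map_sphere. Qed.

(** A homotopy from the inclusion in the next stage to the constant map at the
    base point. *)
Definition contraction n (X : based_mspace) (h : X -> R -> next_stage n X) :=
  [/\ continuous (uncurry h), forall x t, t <= 0 -> h x t = stage_incl n x &
      forall x t, 1 <= t -> h x t = base (next_stage n X)].

(** On the new cells, the homotopy has to start with the characteristic map, to
    end at the base point, and to prolong the image of [h] under the attaching
    map on the boundary; [homotopy_fill] applies as all spheres of
    [next_stage n X] bound in the stage after it. *)
Lemma contraction_extends n (X : based_mspace) (h : X -> R -> next_stage n X) :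
  contraction h ->
  exists2 h' : next_stage n X -> R -> next_stage n.+1 (next_stage n X), contraction h' &
    forall x t, h' (stage_incl n x) t = stage_incl n.+1 (h x t).
Proof.
move=> [ch h0 h1].
have fill (c : new_cells n X) : exists G : euclidean_ball R n.+1 -> R ->
      next_stage n.+1 (next_stage n X),
    [/\ continuous (uncurry G),
        forall b t, t <= 0 -> G b t = stage_incl n.+1 (stage_char (c, b)),
        forall b t, 1 <= t -> G b t = stage_incl n.+1 (base (next_stage n X)) &
        forall s t, G (set_val s) t = stage_incl n.+1 (h (new_attaching (c, s)) t)].
  refine (@homotopy_fill R n (next_stage n X) (next_stage n.+1 (next_stage n X))
    (@stage_incl n.+1 (next_stage n X))
    (fun b => stage_char (c, b))
    (fun s => h (new_attaching (c, s))) (base (next_stage n X)) _ _ _ _ _).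
  - exact: stage_char_cell_continuous.
  - move=> [s t].
    apply: (@cont_eq _ _ _ _ (fun st : euclidean_sphere R n.+1 * R =>
      uncurry h (new_attaching (c, st.1), st.2))); first by case.
    apply: (@cont_comp _ _ _ _ (fun st : euclidean_sphere R n.+1 * R =>
      (new_attaching (c, st.1), st.2)) (uncurry h)); last exact: ch.
    apply: cont_pair; last exact: cvg_snd.
    apply: (@cont_comp _ _ _ _ (fun st : euclidean_sphere R n.+1 * R =>
      (c : discrete_topology _, st.1)) (@new_attaching n X)).
      by apply: cont_pair; [exact: cont_cst|exact: cvg_fst].
    exact: new_attaching_continuous.
  - by move=> s t t0; rewrite h0 // stage_char_sphere.
  - by move=> s t t1; rewrite h1.
  move=> f cf; pose f' : @sphere_family n.+1 (next_stage n X) := exist _ f (mem_set cf).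
  exists (fun b => stage_char ((1%g, f') : new_cells n.+1 (next_stage n X), b)).
  split; first exact: stage_char_cell_continuous.
  move=> s; rewrite stage_char_sphere; congr (stage_incl _ _).
  exact: (@tact1 M (next_stage n X)).
have [G GP] := choice fill.
pose h' (x : next_stage n X) : R -> next_stage n.+1 (next_stage n X) :=
  match x with
  | inl x => fun t => stage_incl n.+1 (h x t)
  | inr cb => G cb.1 (set_val cb.2)
  end.
have h'_char c b : h' (stage_char (c, b)) = G c b.
  rewrite /h' /stage_char /char_map; case: pselect => //= s; apply/funext => t.
  by have [_ _ _ <-] := GP c.
exists h' => //; split.
- apply: attach_uncurry_continuous.
    move=> xt.
    apply: (@cont_eq _ _ _ _ (fun xt => stage_incl n.+1 (uncurry h xt))).
      by case.
    exact: (cont_compT (ch xt) (@stage_incl_continuous _ _)).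
  move=> c; under eq_fun do rewrite h'_char.
  by have [] := GP c.
- move=> [x|[c b]] t t0 /=; first by rewrite h0.
  have [_ -> // _ _] := GP c.
  by rewrite /stage_char char_map_interior.
- move=> [x|[c b]] t t1 /=; first by rewrite h1.
  by have [_ _ -> //] := GP c.
Qed.

Definition skeleton0 : based_mspace :=
  @BasedMSpace (mdiscrete (free_mset M unit)) (1%g, tt).

Definition vertex_at (m : M) : skeleton0 := (m, tt).

Fixpoint skeleton n : based_mspace :=
  if n is n'.+1 then next_stage n' (skeleton n') else skeleton0.

Definition skeleton_cells n : mset M :=
  if n is n'.+1 then new_cells n' (skeleton n') else free_mset M unit.

Definition skeleton_incl n : skeleton n -> skeleton n.+1 :=
  @stage_incl n (skeleton n).

Lemma skeleton_incl_mmap n : is_mmap (@skeleton_incl n).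
Proof. by split; [exact: stage_incl_continuous|]. Qed.

Definition complex_space : mspace M := colim skeleton_incl_mmap.

Fact skeleton_cells_projective n : mset_projective (skeleton_cells n).
Proof. by case: n => [|n]; exact: free_mset_projective. Qed.

Fact skeleton_vertices_iso :
  is_miso (id : mdiscrete (skeleton_cells 0) -> skeleton 0).
Proof.
have mmap_id : is_mmap (id : mdiscrete (skeleton_cells 0) -> skeleton 0).
  by split=> // x.
by split=> //; exists id.
Qed.

Definition complex : projective_mcw R M :=
  @ProjectiveMCW R M complex_space skeleton_cells skeleton skeleton_incl
    (colim_in skeleton_incl) id
    (fun n => @new_attaching n (skeleton n)) (fun n => @stage_char n (skeleton n))
    skeleton_cells_projective skeleton_vertices_iso
    (fun n => attach_pushout (@new_attaching_equiv n (skeleton n))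
       (@new_attaching_continuous n (skeleton n)))
    (colim_universal skeleton_incl_mmap).

Lemma complex_finite : finite_set A -> skel_mfinite complex 1.
Proof.
move=> finA [|[|//]] _.
  by apply: (@free_mset_fg M unit [:: tt]); case.
have /finite_seqP[s Fs] : finite_set (@sphere_family 0 (skeleton 0)).
  exact: finite_image.
have in_s f : @sphere_family 0 (skeleton 0) f -> f \in s by rewrite Fs.
apply: (@free_mset_fg _ _ (pmap insub s)) => f.
by rewrite mem_pmap_sub; apply: in_s; exact: set_valP.
Qed.

Section Contraction.
Hypothesis A_connected : forall m, cayley_connect A m 1%g.

(** The edge from [m] to [m * a] is the characteristic map of the translate by
    [m] of the 1-cell of [a]. *)
Lemma joined_edge m a : A a ->
  joined R (stage_incl 0 (vertex_at m)) (stage_incl 0 (vertex_at (m * a)%g)).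
Proof.
move=> Aa; pose v (t : R) : 'rV[R]_1 := \row_(_ < 1) clamp t.
have v1 t : sqnorm (v t) <= 1 by rewrite /sqnorm big_ord1 mxE clamp_sqr.
have fa : @sphere_family 0 skeleton0 (edge_ends skeleton0 a) by exists a.
pose f : @sphere_family 0 skeleton0 := 
  exist _ (edge_ends skeleton0 a) (mem_set fa).
pose c : new_cells 0 skeleton0 := (m, f).
have endpoint t : clamp t ^+ 2 = 1 -> stage_char (c, to_ball (v t)) =
    stage_incl 0 (vertex_at (if clamp t <= 0 then m else (m * a)%g)).
  move=> c1; have vs : sqnorm (v t) = 1 by rewrite /sqnorm big_ord1 mxE.
  have -> : to_ball (v t) = set_val (mk_sphere vs).
    by apply: ball_inj; rewrite to_ballK.
  rewrite stage_char_sphere; congr (stage_incl _ _).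
  rewrite /new_attaching -[set_val _]/(edge_ends skeleton0 a) /edge_ends.
  rewrite [X in X <= 0](_ : _ = clamp t); last exact: mxE.
  by case: ifP => _; congr (_, tt); rewrite /= !mulg1.
exists (fun t => stage_char (c, to_ball (v t))); split.
- move=> t; apply: (@cont_comp R t _ _ (fun t => to_ball (v t))
    (fun b => stage_char (c, b))); last exact: stage_char_cell_continuous.
  apply: cont_comp; last exact: to_ball_continuous.
  apply: continuous_row => i; refine (@cont_eq R t R _ (@clamp R) _ _).
    by move=> u; rewrite mxE.
  exact: clamp_continuous.
- move=> t t0; rewrite endpoint clamp_le // ?sqrrN ?expr1n // ifT //; lra.
- move=> t t1; rewrite endpoint clamp_ge // ?expr1n // ifF //.
  by apply/negbTE; lra.
Qed.

Lemma contraction0 : exists h : skeleton0 -> R -> next_stage 0 skeleton0,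
  contraction h.
Proof.
have conn (x : skeleton0) :
    joined R (stage_incl 0 x) (base (next_stage 0 skeleton0)).
  case: x => m []; change (base _) with (stage_incl 0 (vertex_at 1%g)).
  change (m, tt) with (vertex_at m).
  elim: (A_connected m) => {m} [m m' [[m1 b] /= [<- <-]]|m|m m' _ mm'|m m' m'' _ mm' _].
  - by apply: joined_edge; exact: set_valP.
  - exact: joined_refl.
  - exact: joined_sym.
  - exact: joined_trans.
have [h hP] := choice conn; exists h; split.
- apply: (@continuous_discrete_prod _ _ _ (uncurry h)) => x.
  by have [] := hP x.
- by move=> x; have [] := hP x.
- by move=> x; have [] := hP x.
Qed.

(** The contractions of the stages are chosen one after the other, each
    extending the previous one. *)
Lemma complex_contractible : contractible R complex.
Proof.
have [k0 k0P] := contraction0.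
have [h [_ hP hi]] := dependent_sequence
  (P := fun n (h : skeleton n -> R -> skeleton n.+1) => @contraction n (skeleton n) h)
  (Q := fun n (h : skeleton n -> R -> skeleton n.+1)
     (h' : skeleton n.+1 -> R -> skeleton n.+2) =>
     forall x t, h' (skeleton_incl x) t = skeleton_incl (h x t))
  k0P (fun n h hP => contraction_extends hP).
pose incl n (x : skeleton n) : complex := colim_in skeleton_incl x.
have [H [cH HE]] : exists H : complex * R -> complex,
    continuous H /\ forall n (x : skeleton n) t, H (incl n x, t) = incl n.+1 (h n x t).
  apply: (@colim_homotopy M skeleton skeleton_incl skeleton_incl_mmap R complex
    (fun n x t => incl n.+1 (h n x t))).
    move=> n xt; have [ch _ _] := hP n.
    apply: (@cont_eq _ _ complex _ (fun xt => incl n.+1 (uncurry (h n) xt))).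
      by case.
    exact: (cont_comp (ch xt) (@colim_in_continuous _ _ _ n.+1 _)).
  by move=> n x; apply/funext => t; rewrite hi; exact: colim_in_step.
have incl_base n : incl n (base (skeleton n)) = incl 0%N (base (skeleton 0)).
  by elim: n => // n <-; exact: (colim_in_step _ (base (skeleton n))).
exists (incl 0%N (base (skeleton 0))), H; split.
- exact: continuous_subspaceT.
- move=> z; have [n [x <-]] := colim_in_surj z.
  have [_ h0 _] := hP n; rewrite HE h0 //; exact: colim_in_step.
- move=> z; have [n [x <-]] := colim_in_surj z.
  by have [_ _ h1] := hP n; rewrite HE h1.
Qed.

End Contraction.
End Construction.

Lemma left_F1_of_cayley (R : realType) (M : monoidType) (A : set M) :
  finite_set A -> connected_undirected (cayley_digraph M A) -> left_F R M 1.
Proof.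
move=> finA conn; exists (complex R A); split; last exact: complex_finite.
by apply: complex_contractible => m; exact: conn.
Qed.

(** * Maps to discrete spaces *)

Section Connectedness.
Variable R : realType.

Lemma within_comp_continuous (S T U : topologicalType) (D : set T)
    (f : T -> U) (p : S -> T) :
  {within D, continuous f} -> continuous p -> (forall s, D (p s)) ->
  continuous (fun s => f (p s)).
Proof.
move=> /subspace_continuousP cf cp Dp s V /(cf _ (Dp s)) fV.
have := cp s _ fV; rewrite /nbhs /=; apply: filterS => s'; apply; exact: Dp.
Qed.

(** Otherwise the indicator function of the complement of [g 0], composed with
    [g], would violate the intermediate value theorem. *)
Lemma discrete_path_constant (Y : choiceType) (g : R -> discrete_topology Y) :
  continuous g -> g 0 = g 1.
Proof.
move=> cg; apply/eqP; apply: contraT => g01.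
pose chi (y : discrete_topology Y) : R := if y == g 0 then 0 else 1.
have cchi : continuous chi by exact: continuous_from_discrete.
have chi0 : chi (g 0) = 0 by rewrite /chi eqxx.
have chi1 : chi (g 1) = 1 by rewrite /chi eq_sym (negbTE g01).
have cc : {within `[0, 1], continuous (fun t => chi (g t))}.
  apply: continuous_subspaceT => t; exact: (cont_comp (cg t) (cchi (g t))).
have [|c _] := @IVT R (fun t => chi (g t)) 0 1 (1 / 2) ler01 cc.
  by rewrite chi0 chi1 min_l ?max_r //; lra.
by rewrite /chi; case: ifP => _ e; exfalso; lra.
Qed.

Lemma joined_discrete (Y : choiceType) (T : topologicalType)
    (g : T -> discrete_topology Y) (p : R -> T) :
  continuous g -> continuous p -> g (p 0) = g (p 1).
Proof.
move=> cg cp; apply: (@discrete_path_constant Y (fun t => g (p t))) => t.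
exact: (cont_comp (cp t) (cg (p t))).
Qed.

Lemma sqnorm_eq0 n (y : 'rV[R]_n) : sqnorm y = 0 -> y = 0.
Proof.
move=> /eqP; rewrite psumr_eq0 => [/allP y0|i _]; last exact: sqr_ge0.
apply/rowP => i; rewrite mxE; apply/eqP.
by have := y0 i (mem_index_enum i); rewrite sqrf_eq0.
Qed.

Lemma to_sphereK n (s : euclidean_sphere R n.+1) :
  to_sphere (set_val (set_val s)) = s.
Proof.
apply: sphere_inj; rewrite to_sphereE in_sphere ?oner_neq0 //.
by rewrite sqrtr1 invr1 scale1r.
Qed.

Lemma sqr_1sub_inj (t : R) : (1 - t) ^+ 2 = t ^+ 2 -> t != 0 /\ 1 - t = t.
Proof.
move=> e; have t2 : t = 1 / 2 by lra.
by rewrite t2; split; [apply/eqP|]; lra.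
Qed.

Section SphereToDiscrete.
Variables (n : nat) (Y : choiceType).
Variable f : euclidean_sphere R n.+2 -> discrete_topology Y.
Hypothesis cf : continuous f.

(** Two points that are not antipodal are joined by the radial projection of the
    segment between them, which avoids 0. *)
Lemma sphere_to_discrete_segment s s' :
  set_val (set_val s) != - set_val (set_val s') :> 'rV[R]_n.+2 -> f s = f s'.
Proof.
set x : 'rV[R]_n.+2 := set_val (set_val s).
set y : 'rV[R]_n.+2 := set_val (set_val s').
move=> xNy; pose v (t : R) : 'rV[R]_n.+2 := (1 - t) *: x + t *: y.
have v0 t : sqnorm (v t) != 0.
  apply: contra xNy => /eqP/sqnorm_eq0/eqP; rewrite addr_eq0 -scalerN => /eqP e.
  have := congr1 (@sqnorm R _) e; rewrite !sqnormZ.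
  rewrite -scaleN1r sqnormZ sqrrN expr1n mul1r !in_sphere !mulr1 => e2.
  have [t0 t1] := sqr_1sub_inj e2.
  by move: e; rewrite t1 => /(scalerI t0)/eqP; rewrite scaleN1r.
have cp : continuous (fun t => to_sphere (v t)).
  move=> t; apply: (@cont_comp R t _ _ v (@to_sphere R n.+1)); last first.
    exact: to_sphere_continuous.
  apply: continuous_row => i.
  refine (@cont_eq R t R _ (fun t => (1 - t) * x ord0 i + t * y ord0 i) _ _).
    by move=> u; rewrite !mxE.
  have ct : {for t, continuous (fun u : R => u)} by [].
  apply: (@contD R R t (fun t => (1 - t) * x ord0 i) (fun t => t * y ord0 i)).
    apply: (@contM R R t (fun t => 1 - t) (fun=> x ord0 i)); last exact: cont_cst.
    by apply: (@contD R R t (fun=> 1) (fun t => - t)); [exact: cont_cst|exact: contN].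
  by apply: (@contM R R t (fun t => t) (fun=> y ord0 i)); last exact: cont_cst.
have := joined_discrete cf cp; rewrite /v subr0 subrr !scale0r !scale1r addr0 add0r.
by rewrite !to_sphereK.
Qed.

(** The point antipodal to the pole is joined to it through a third point, which
    exists in dimension at least 1. *)
Lemma sphere_to_discrete s s' : f s = f s'.
Proof.
suff H s1 : f s1 = f (mk_sphere (@sqnorm_pole R n.+1)) by rewrite !H.
have [e|] := eqVneq (set_val (set_val s1) : 'rV[R]_n.+2) (- pole R n.+1); last first.
  by move=> ne; apply: sphere_to_discrete_segment; exact: ne.
pose e1 : 'rV[R]_n.+2 := delta_mx ord0 (lift ord0 ord0).
have e1s : sqnorm e1 = 1.
  rewrite /sqnorm (bigD1 (lift ord0 ord0)) //= mxE !eqxx expr1n big1 ?addr0 //.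
  by move=> i /negbTE i1; rewrite mxE i1 expr0n.
have e1_0 : e1 ord0 ord0 = 0 by rewrite mxE.
have pole_0 : pole R n.+1 ord0 ord0 = 1 by rewrite mxE.
have pole_e1 : - pole R n.+1 != - e1.
  by apply/eqP => /rowP/(_ ord0); rewrite [LHS]mxE [RHS]mxE pole_0 e1_0; lra.
have e1_pole : e1 != - pole R n.+1.
  by apply/eqP => /rowP/(_ ord0); rewrite [RHS]mxE pole_0 e1_0; lra.
transitivity (f (mk_sphere e1s)); apply: sphere_to_discrete_segment.
  by rewrite e; exact: pole_e1.
exact: e1_pole.
Qed.

End SphereToDiscrete.

End Connectedness.

Section MapsToDiscrete.
Variables (R : realType) (M : monoidType) (X : projective_mcw R M) (Q : mset M).
Variable u0 : skel X 0 -> mdiscrete Q.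
Hypothesis u0_mmap : is_mmap u0.
Hypothesis u0_edges : forall c s s',
  u0 (attaching_map (p := X) (n := 0) (c, s)) =
  u0 (attaching_map (p := X) (n := 0) (c, s')).

(** A map to a discrete space that is constant on the boundary of each cell
    extends to the cell by that constant. For the cells of dimension at least 2
    the condition holds automatically, the boundary being connected. *)
Lemma extend_to_discrete : exists w : X -> mdiscrete Q,
  is_mmap w /\ forall x, w (skel_colim x) = u0 x.
Proof.
pose P n (u : skel X n -> mdiscrete Q) := is_mmap u /\ forall c s s',
  u (attaching_map (p := X) (n := n) (c, s)) =
  u (attaching_map (p := X) (n := n) (c, s')).
pose E n (u : skel X n -> mdiscrete Q) (u' : skel X n.+1 -> mdiscrete Q) :=
  forall x, u' (skel_incl x) = u x.
have P0 : P 0%N u0 by [].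
have [|u [u_0 uP uE]] := @dependent_sequence _ P E u0 P0.
  move=> n u [[cu eu] u_sphere].
  pose s0 : euclidean_sphere R n.+1 := mk_sphere (@sqnorm_pole R n).
  have [[_ [c_att e_att] _ _] _ univ] := @skel_pushout R M X n.
  pose v (x : mprod (cells X n.+1) (euclidean_ball R n.+1)) : mdiscrete Q :=
    u (attaching_map (p := X) (n := n) (x.1, s0)).
  have [|||w [[w_mmap w_char w_incl] _]] := univ (mdiscrete Q) v u.
  - split=> [|m x]; first by apply: continuous_discrete_prod => c k;
      exact: (@cont_cst _ k (mdiscrete Q) (v (c, k))).
    by rewrite /v -eu -e_att.
  - by [].
  - by case=> c s; exact: u_sphere.
  exists w => //; split=> // c s s'.
  have [[_ [c_att' _] _ _] _ _] := @skel_pushout R M X n.+1.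
  apply: (@sphere_to_discrete R n _
    (fun s => w (attaching_map (p := X) (n := n.+1) (c, s)))).
  move=> t; apply: (@cont_comp _ t _ _
    (fun s => attaching_map (p := X) (n := n.+1) (c, s)) w); last exact: w_mmap.1.
  apply: (@cont_comp _ t _ _ (fun s => (c : discrete_topology _, s))
    (@attaching_map _ _ X n.+1)); last exact: c_att'.
  by apply: cont_pair; [exact: cont_cst|].
have [_ _ _ univ] := @mcw_colimit R M X.
have [w [[w_mmap wE] _]] := univ (mdiscrete Q) u (fun n => (uP n).1) uE.
by exists w; split=> // x; rewrite wE u_0.
Qed.

End MapsToDiscrete.

Lemma contractible_to_discrete (R : realType) (M : monoidType) (X : mspace M)
    (Q : mset M) (w : X -> mdiscrete Q) :
  contractible R X -> continuous w -> forall x y, w x = w y.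
Proof.
move=> [x0 [H [cH H0 H1]]] cw.
suff wx0 x : w x = w x0 by move=> x y; rewrite !wx0.
rewrite -[in LHS](H0 x) -(H1 x).
pose tau (t : R) := (1 + clamp t) / 2.
have tau01 t : 0 <= tau t <= 1.
  have := clamp_sqr t; rewrite /tau; nra.
have cp : continuous (fun t => H (x, tau t)).
  apply: (within_comp_continuous cH (p := fun t => (x, tau t))) => [t|t]; last first.
    by split=> //=; rewrite in_itv; exact: tau01.
  apply: cont_pair; first exact: cont_cst.
  apply: (@contM R R t (fun t => 1 + clamp t) (fun=> 2^-1)); last exact: cont_cst.
  by apply: (@contD R R t (fun=> 1) (@clamp R));
    [exact: cont_cst|exact: clamp_continuous].
have := joined_discrete (cw : continuous (w : X -> discrete_topology Q)) cp.
rewrite /tau clamp_le // clamp_ge // subrr mul0r.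
by rewrite (_ : (1 + 1) / 2 = 1) //; field.
Qed.

(** * From type left-F_1 to the Cayley digraph *)

Section Power.
Variable M : monoidType.

(** The action on the functions from [M] to truth values that comes from right
    multiplication: each subset [U] of [M] gives an equivariant map from [M] to
    this set, sending [m] to the set of [x] with [x * m] in [U]. *)
Definition translate (m : M) (U : set M) : set M := [set x | U (x * m)%g].

Fact translate1 U : translate 1%g U = U.
Proof. by apply/funext => x; rewrite /translate /= mulg1. Qed.

Fact translateM a b U : translate (a * b)%g U = translate a (translate b U).
Proof. by apply/funext => x; rewrite /translate /= mulgA. Qed.

Definition translated_sets : mset M := MSet translate1 translateM.

End Power.

Definition empty_mset (M : monoidType) : mset M :=
  @MSet M void (fun=> id) (fun=> erefl) (fun _ _ _ => erefl).

(** A section of the free cover of [P] by its own elements, followed by the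
    first projection. *)
Lemma projective_retraction (M : monoidType) (P : mset M) :
  mset_projective P -> exists v : P -> M, forall m p, v (sact m p) = (m * v p)%g.
Proof.
move=> projP; pose f (x : free_mset M P) : P := sact x.1 x.2.
have [|p|s [s_eq _]] := projP (free_mset M P) f.
- by move=> m [a p]; rewrite /f /= sactM.
- by exists (1%g, p); rewrite /f /= sact1.
by exists (fun p => (s p).1) => m p; rewrite s_eq.
Qed.

Lemma left_F1_cayley (R : realType) (M : monoidType) : left_F R M 1 ->
  exists2 A : set M, finite_set A & connected_undirected (cayley_digraph M A).
Proof.
move=> [X [contrX finX]].
have [_ [g [[cg eg] vK gK]]] := vertex_map_iso X.
have [val val_eq] := projective_retraction (@cells_projective _ _ X 0).
have [s1 gen1] := finX 1%N isT.
pose att := @attaching_map _ _ X 0.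
have [[_ [_ att_eq] _ _] _ _] := @skel_pushout R M X 0.
(* If there were no vertex, all skeleta would map to the empty set. *)
have cells0 : exists p : cells X 0, True.
  apply: contrapT => noP.
  have nocell (x : skel X 0) : False by apply: noP; exists (g x).
  pose u0 (x : skel X 0) : mdiscrete (empty_mset M) := False_rect _ (nocell x).
  have [| |w _] := @extend_to_discrete R M X _ u0.
  - by split=> [x|m x]; case: (nocell x).
  - by move=> c s; case: (nocell (att (c, s))).
  by have [x0 _] := contrX; case: (w x0).
have [p0 _] := cells0.
pose north : euclidean_sphere R 1 := mk_sphere (@sqnorm_pole R 0).
have south1 : sqnorm (- pole R 0) = 1.
  by rewrite -scaleN1r sqnormZ sqnorm_pole sqrrN expr1n mulr1.
pose south : euclidean_sphere R 1 := mk_sphere south1.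
have poles s : s = north \/ s = south.
  have := in_sphere s; rewrite /sqnorm big_ord1 => /eqP; rewrite sqrf_eq1.
  by move=> /orP[] /eqP s00; [left|right]; apply: sphere_inj; apply/rowP => i;
    rewrite ord1 s00 ?mxE ?[RHS]mxE /= ?mxE.
pose ends c : seq M := [:: val (g (att (c, north))); val (g (att (c, south)))].
pose As := val p0 :: flatten (map ends s1).
exists [set` As]; first by apply/finite_seqP; exists As.
set A := [set` As].
have Ap0 : A (val p0) by rewrite /A /= mem_head.
have Aend c s : c \in s1 -> A (val (g (att (c, s)))).
  move=> cs1; rewrite /A /= inE; apply/orP; right; apply/flatten_mapP.
  by exists c => //; case: (poles s) => ->; rewrite !inE eqxx ?orbT.
(* The vertices [p] and [p'] have the same image if and only if, for each [x],
   the elements [x * val p] and [x * val p'] are both in the component of 1 or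
   both outside. *)
pose comp (p : cells X 0) : translated_sets M :=
  [set x | cayley_connect A 1%g (x * val p)%g].
have comp_eq m p : comp (sact m p) = sact m (comp p).
  by apply/funext => x; rewrite /comp /= val_eq mulgA.
have comp_edge c s s' : comp (g (att (c, s))) = comp (g (att (c, s'))).
  have [m [c0 c0s1 ->]] := gen1 c.
  have attE t : g (att (sact m c0, t)) = sact m (g (att (c0, t))).
    by have := congr1 g (att_eq m (c0, t)); rewrite eg.
  apply/funext => x; apply/propext; rewrite /comp /= !attE !val_eq !mulgA.
  have e : cayley_connect A (x * m * val (g (att (c0, s))))%g
      (x * m * val (g (att (c0, s'))))%g.
    exact: (@cayley_connect_edge M A _ _ (x * m)%g _ _
      (Aend c0 s c0s1) (Aend c0 s' c0s1) erefl erefl).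
  by split=> h; apply: rst_trans h _ => //; exact: rst_sym.
have [| |w [[cw _] wE]] := @extend_to_discrete R M X _ (comp \o g).
- split=> [x|m x]; last by rewrite /= eg comp_eq.
  apply: (@cont_comp _ x _ (mdiscrete _) g comp); first exact: cg.
  exact: continuous_from_discrete.
- exact: comp_edge.
have comp_cst p : comp p = comp p0.
  have compE x : comp (g x) = w (skel_colim x) by rewrite wE.
  by rewrite -(vK p) -(vK p0) !compE; exact: (contractible_to_discrete contrX cw).
apply: cayley_connected => m.
have : comp p0 1%g.
  by rewrite /comp /=; exact: cayley_edge.
rewrite -(comp_cst (sact m p0)) /comp /= mul1g val_eq => h.
by apply: rst_trans h _; apply/rst_sym/cayley_edge.
Qed.

(** * The equivalence *)

Theorem theorem6p13 (R : realType) (M : monoidType) :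
  [/\ left_F R M 1 <-> left_FP M 1,
      left_FP M 1 <->
        (exists2 A : set M, finite_set A &
           connected_undirected (cayley_digraph M A)) &
      monoid_fg M -> left_F R M 1].
Proof.
split.
- split=> [/left_F1_cayley|/left_FP1_cayley] [A finA conn].
    exact: left_FP1_of_cayley finA conn.
  exact: left_F1_of_cayley finA conn.
- split; first exact: left_FP1_cayley.
  by move=> [A finA conn]; exact: left_FP1_of_cayley finA conn.
- by move=> /monoid_fg_cayley[A finA conn]; exact: left_F1_of_cayley finA conn.
Qed.
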